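(* Let $(M,L)$ and $(M,\widetilde L)$ be conformally related Finsler manifolds with $\widetilde g=e^{2\sigma(x)}g$. The associated Hashiguchi connections $D^{*}$ and $\widetilde{D^{*}}$ are related by $$\widetilde{D^{*}}_{X}\overline{Y}=D^{*}_{X}\overline{Y}+\omega^{*}(X,\overline{Y})$$ for all vector fields $X$ on $\mathcal{T}M$ and all $\pi$-vector fields $\overline Y$, where $$\omega^{*}(X,\overline{Y})=(D^{*}_{\gamma\overline Y}N)(\rho X)+N\,T(\overline{Y},\rho X).$$ In particular, for all $\pi$-vector fields $\overline X,\overline Y$: (a) $\widetilde{D^{*}}_{\gamma\overline{X}}\overline{Y}=D^{*}_{\gamma\overline{X}}\overline{Y}$; (b) $\widetilde{D^{*}}_{\widetilde{\beta}\overline{X}}\overline{Y}=D^{*}_{\beta\overline{X}}\overline{Y}-D^{*}_{\gamma N\overline{X}}\overline Y+B^{*}(\overline{X},\overline Y)$, where $B^{*}(\overline{X},\overline{Y}):=\omega^{*}(\beta\overline{X},\overline{Y})$.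
   Context: $M$ is a real paracompact $C^\infty$ manifold of finite dimension $n$; all objects are $C^\infty$. $\pi:\mathcal{T}M\to M$ is the bundle of nonzero tangent vectors, $\pi^{-1}(TM)$ the pullback of $TM$ by $\pi$. Sections of $\pi^{-1}(TM)$ are called $\pi$-vector fields and written $\overline X,\overline Y,\dots$; $\overline\eta(u)=(u,u)$. $\rho:T(\mathcal{T}M)\to\pi^{-1}(TM)$ is $\rho=(\pi_{\mathcal{T}M},d\pi)$ and $\gamma:\pi^{-1}(TM)\to T(\mathcal{T}M)$ is the vertical lift. For a linear connection $D$ on $\pi^{-1}(TM)$, $K(X):=D_X\overline\eta$; $D$ is regular if $T(\mathcal{T}M)=V(\mathcal{T}M)\oplus H(\mathcal{T}M)$ with $H=\ker K$, $V$ the vertical bundle, and then $\beta:=(\rho|_{H})^{-1}$. Torsion: $\mathbf{T}(X,Y)=D_X\rho Y-D_Y\rho X-\rho[X,Y]$, $Q(\overline X,\overline Y)=\mathbf{T}(\beta\overline X,\beta\overline Y)$, (h)hv-torsion $T(\overline X,\overline Y)=\mathbf{T}(\gamma\overline X,\beta\overline Y)$. Curvature: $\mathbf{K}(X,Y)\rho Z=-D_XD_Y\rho Z+D_YD_X\rho Z+D_{[X,Y]}\rho Z$; $P(\overline X,\overline Y)\overline Z=\mathbf{K}(\beta\overline X,\gamma\overline Y)\overline Z$, $\widehat P(\overline X,\overline Y)=P(\overline X,\overline Y)\overline\eta$. $(M,L)$ is a Finsler manifold and $g$ the Finsler metric on $\pi^{-1}(TM)$ defined by $L$. The Cartan connection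 $\nabla$ is the unique regular connection with $\nabla g=0$, $Q=0$ and $g(T(\overline X,\overline Y),\overline Z)=g(T(\overline X,\overline Z),\overline Y)$; $T$, $K$, $\beta$, $\widehat P$ denote those of $\nabla$. The Hashiguchi connection is $D^{*}_X\overline Y=\nabla_X\overline Y+\widehat P(\rho X,\overline Y)$ (same $\beta$, $K$). $(M,L)$ and $(M,\widetilde L)$ are conformally related if $\widetilde g=e^{2\sigma(x)}g$ for a positive differentiable function $\sigma$ on $M$. Objects of $(M,\widetilde L)$ carry a tilde. $N(\overline X):=\widetilde\nabla_{\beta\overline X}\overline\eta-\nabla_{\beta\overline X}\overline\eta$, a $\pi$-tensor field of type $(1,1)$, so that $\widetilde\beta=\beta-\gamma\circ N$; $(D^{*}_{\gamma\overline Y}N)(\overline X)=D^{*}_{\gamma\overline Y}(N\overline X)-N(D^{*}_{\gamma\overline Y}\overline X)$. *)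

(* Defs.v *)
From HB Require Import structures.
From mathcomp Require Import all_boot all_order all_algebra.
From mathcomp Require Import all_classical all_reals all_analysis.

Set Implicit Arguments.
Unset Strict Implicit.
Unset Printing Implicit Defensive.
Import Order.TTheory GRing.Theory Num.Theory numFieldNormedType.Exports.
Local Open Scope classical_set_scope.
Local Open Scope ring_scope.

Section Calculus.
Context {R : realType} {V W : normedModType R}.

Definition iter_derive (s : seq V) (f : V -> W) : V -> W :=
  foldr (fun v (g : V -> W) => 'D_v g) f s.

(* C^oo near x, for finite-dimensional V: near x, all iterated directional
   derivatives are Frechet differentiable. *)
Definition smooth_near (f : V -> W) (x : V) : Prop :=
  \forall y \near x, forall s : seq V, differentiable (iter_derive s f) y.

End Calculus.

Definition paracompact_space (T : topologicalType) : Prop :=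
  forall C : set (set T),
    (forall U, C U -> open U) -> \bigcup_(U in C) U = setT ->
  exists C' : set (set T),
    [/\ forall V, C' V -> open V,
        \bigcup_(V in C') V = setT,
        forall V, C' V -> exists2 U, C U & V `<=` U &
        forall p : T, exists2 O, nbhs p O &
          finite_set [set V | C' V /\ V `&` O !=set0]].

(* Charts of a set N with values in F.  [bwd i] is the partial inverse of the
   chart [fwd i : dom i -> F] ([None] off its image), and [pref p] is a chart
   chosen around p.  The tangent space at p is F itself, a vector being given by
   its components in the chart [pref p]. *)
Record charts (R : realType) (N : Type) (F : normedModType R) := Charts {
  idx : Type;
  dom : idx -> set N;
  fwd : idx -> N -> F;
  bwd : idx -> F -> option N;
  pref : N -> idx }.

Section Charts.
Context {R : realType} {N : Type} {F : normedModType R} (A : charts N F).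

(* f read in the chart i, extended by 0 off the image of the chart *)
Definition rep {W : normedModType R} (i : idx A) (f : N -> W) : F -> W :=
  fun x => oapp f 0 (bwd i x).

Definition smooth_at {W : normedModType R} (f : N -> W) (p : N) : Prop :=
  forall i : idx A, dom i p -> smooth_near (rep i f) (fwd i p).

Definition smooth {W : normedModType R} (f : N -> W) : Prop :=
  forall p, smooth_at f p.

(* d_p f (v), for v in T_p N *)
Definition tdiff {W : normedModType R} (p : N) (f : N -> W) (v : F) : W :=
  'd (rep (pref A p) f) (fwd (pref A p) p) v.

(* components in the chart i of v in T_p N *)
Definition tcoord (i : idx A) (p : N) (v : F) : F := tdiff p (fwd i) v.

(* components in the chart i of the vector field X *)
Definition field_comp (i : idx A) (X : N -> F) : N -> F :=
  fun p => tcoord i p (X p).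

Definition vsmooth_at (X : N -> F) (p : N) : Prop :=
  forall i : idx A, dom i p -> smooth_near (rep i (field_comp i X)) (fwd i p).

Definition vsmooth (X : N -> F) : Prop := forall p, vsmooth_at X p.

(* [X, Y]^k = X^j d_j Y^k - Y^j d_j X^k, so that [X, Y] f = X (Y f) - Y (X f) *)
Definition lie (X Y : N -> F) : N -> F := fun p =>
  tdiff p (field_comp (pref A p) Y) (X p)
  - tdiff p (field_comp (pref A p) X) (Y p).

End Charts.

Definition tmap {R : realType} {N N' : Type} {F F' : normedModType R}
    (A : charts N F) (A' : charts N' F') (f : N -> N') (p : N) (v : F) : F' :=
  tdiff A p (fun q => fwd (pref A' (f p)) (f q)) v.

Record smooth_manifold {R : realType} {M : topologicalType}
    {F : normedModType R} (A : charts M F) : Prop := SmoothManifold {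
  mfd_hausdorff : hausdorff_space M;
  mfd_paracompact : paracompact_space M;
  mfd_pref : forall p, dom (pref A p) p;
  mfd_open : forall i : idx A, open (dom i);
  mfd_fwdK : forall (i : idx A) p, dom i p -> bwd i (fwd i p) = Some p;
  mfd_bwdK : forall (i : idx A) x p,
    bwd i x = Some p -> dom i p /\ fwd i p = x;
  mfd_continuous : forall (i : idx A) p, dom i p -> {for p, continuous (fwd i)};
  mfd_open_map : forall (i : idx A) (U : set M),
    open U -> U `<=` dom i -> open (fwd i @` U);
  mfd_transition : forall (i j : idx A) p, dom i p -> dom j p ->
    smooth_near (rep i (fwd j)) (fwd i p) }.

Section Slit.
Context {R : realType} {n : nat} {M : topologicalType}.
Local Notation E := 'rV[R]_n.
Variable A : charts M E.

(* TM is M * E, and the bundle of nonzero tangent vectors is the following. *)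
Definition slit : Type := {u : M * E | u.2 != 0}.

Definition proj (u : slit) : M := (val u).1.

Definition tangent_fwd (i : idx A) (q : M * E) : E * E :=
  (fwd i q.1, tcoord i q.1 q.2).

(* (x, y) |-> the vector y^j d/dx^j at the point of coordinates x *)
Definition tangent_bwd (i : idx A) (z : E * E) : option (M * E) :=
  omap (fun p => (p, 'd (rep i (fwd (pref A p))) (z.1) z.2)) (bwd i z.1).

Definition slit_charts : charts slit (E * E)%type :=
  @Charts R slit (E * E)%type (idx A)
    (fun i => proj @^-1` dom i)
    (fun i u => tangent_fwd i (val u))
    (fun i z => obind insub (tangent_bwd i z))
    (fun u => pref A (proj u)).
Local Notation S := slit_charts.

(* A pi-vector field is a map Y : slit -> E, with Y u in T_(proj u) M; a vector
   field on slit is a map X : slit -> E * E, with X u in T_u slit. *)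
Definition pi_smooth_at (Y : slit -> E) (u : slit) : Prop :=
  forall i : idx A, dom i (proj u) ->
    smooth_near (rep (A := S) i (fun w => tcoord i (proj w) (Y w)))
                (fwd (c := S) i u).

Definition pi_smooth (Y : slit -> E) : Prop := forall u, pi_smooth_at Y u.

Definition eta : slit -> E := fun u => (val u).2.

Definition rho (X : slit -> E * E) : slit -> E :=
  fun u => tmap S A proj u (X u).

(* velocity at t = 0 of t |-> u + t Y(u) *)
Definition gam (Y : slit -> E) : slit -> E * E := fun u =>
  derive1 (fun t : R =>
    tangent_fwd (pref A (proj u)) (proj u, (val u).2 + t *: Y u)) 0.

(* D u w Y is the covariant derivative at u of Y along w in T_u slit.  As usual
   for connections, D also acts on sections which are only smooth near u; the
   Leibniz rule forces D u w Y to depend only on the germ of Y at u. *)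
Definition connection := forall u : slit, E * E -> (slit -> E) -> E.

Definition cov (D : connection) (X : slit -> E * E) (Y : slit -> E) : slit -> E :=
  fun u => D u (X u) Y.

Record linear_connection (D : connection) : Prop := LinearConnection {
  conn_linear : forall u (a : R) (v w : E * E) Y, pi_smooth_at Y u ->
    D u (a *: v + w) Y = a *: D u v Y + D u w Y;
  conn_add : forall u w Y Z, pi_smooth_at Y u -> pi_smooth_at Z u ->
    D u w (fun q => Y q + Z q) = D u w Y + D u w Z;
  conn_leibniz : forall u w (f : slit -> R) Y,
    smooth_at S f u -> pi_smooth_at Y u ->
    D u w (fun q => f q *: Y q) = tdiff S u f w *: Y u + f u *: D u w Y;
  conn_smooth : forall u X Y, vsmooth_at S X u -> pi_smooth_at Y u ->
    pi_smooth_at (cov D X Y) u }.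

Section Connection.
Variable D : connection.

Definition vertical (u : slit) : set (E * E) :=
  [set w | tmap S A proj u w = 0].

Definition horizontal (u : slit) : set (E * E) := [set w | D u w eta = 0].

Definition regular : Prop := forall u : slit,
  vertical u `&` horizontal u = [set 0] /\
  forall w : E * E, exists v h,
    [/\ vertical u v, horizontal u h & w = v + h].

(* the horizontal vector over Y u; it exists and is unique if D is regular *)
Definition bet (Y : slit -> E) : slit -> E * E := fun u =>
  xget 0 [set w | horizontal u w /\ tmap S A proj u w = Y u].

Definition torsion (X Y : slit -> E * E) : slit -> E := fun u =>
  cov D X (rho Y) u - cov D Y (rho X) u - rho (lie S X Y) u.

Definition Qtor (X Y : slit -> E) : slit -> E := torsion (bet X) (bet Y).

Definition Ttor (X Y : slit -> E) : slit -> E := torsion (gam X) (bet Y).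

Definition curvature (X Y : slit -> E * E) (Z : slit -> E) : slit -> E :=
  fun u => - cov D X (cov D Y Z) u + cov D Y (cov D X Z) u
           + cov D (lie S X Y) Z u.

Definition Pcurv (X Y Z : slit -> E) : slit -> E :=
  curvature (bet X) (gam Y) Z.

Definition Phat (X Y : slit -> E) : slit -> E := Pcurv X Y eta.

(* the Hashiguchi connection, when D is the Cartan connection *)
Definition hashiguchi (X : slit -> E * E) (Y : slit -> E) : slit -> E :=
  fun u => cov D X Y u + Phat (rho X) Y u.

End Connection.

(* second derivative along v and w of L^2 / 2 restricted to the fibre of u *)
Definition finsler_metric (L : M * E -> R) (u : slit) (v w : E) : R :=
  'D_v ('D_w (fun y : E => L (proj u, y) ^+ 2 / 2)) (val u).2.

Record finsler (L : M * E -> R) : Prop := Finsler {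
  finsler_smooth : smooth S (fun u : slit => L (val u));
  finsler_pos : forall u : slit, 0 < L (val u);
  finsler_homog : forall p (y : E) (t : R), 0 < t -> L (p, t *: y) = t * L (p, y);
  finsler_posdef : forall u (v : E), v != 0 -> 0 < finsler_metric L u v v }.

Record cartan_connection (L : M * E -> R) (D : connection) : Prop :=
    CartanConnection {
  cartan_linear : linear_connection D;
  cartan_regular : regular D;
  cartan_metric : forall u w Y Z, pi_smooth_at Y u -> pi_smooth_at Z u ->
    tdiff S u (fun q => finsler_metric L q (Y q) (Z q)) w
    = finsler_metric L u (D u w Y) (Z u) + finsler_metric L u (Y u) (D u w Z);
  cartan_Q : forall u X Y, pi_smooth_at X u -> pi_smooth_at Y u ->
    Qtor D X Y u = 0;
  cartan_T : forall u X Y Z,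
    pi_smooth_at X u -> pi_smooth_at Y u -> pi_smooth_at Z u ->
    finsler_metric L u (Ttor D X Y u) (Z u)
    = finsler_metric L u (Ttor D X Z u) (Y u) }.

Definition conformal (L Lt : M * E -> R) (sigma : M -> R) : Prop :=
  [/\ smooth A sigma, forall p, 0 < sigma p &
      forall u v w, finsler_metric Lt u v w
                    = expR (2 * sigma (proj u)) * finsler_metric L u v w].

(* D is the Cartan connection of L and Dt that of Lt. *)
Section Change.
Variables D Dt : connection.

Definition Nten (X : slit -> E) : slit -> E :=
  fun u => cov Dt (bet D X) eta u - cov D (bet D X) eta u.

(* (D*_X N)(Y) *)
Definition hash_dN (X : slit -> E * E) (Y : slit -> E) : slit -> E :=
  fun u => hashiguchi D X (Nten Y) u - Nten (hashiguchi D X Y) u.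

Definition omega_star (X : slit -> E * E) (Y : slit -> E) : slit -> E :=
  fun u => hash_dN (gam Y) (rho X) u + Nten (Ttor D Y (rho X)) u.

Definition B_star (X Y : slit -> E) : slit -> E := omega_star (bet D X) Y.

End Change.
End Slit.

(* Main.v *)
(** Write [K z = D_z eta], and let the prime denote differentiation along the
   fibres, in a chart.  For the Cartan connection D of L, compatibility with the
   metric and the symmetry of T give, at each point,
     2 g (T (X, Y), Z) = the third derivative of L^2 / 2 along the fibre,
   with [T (X, Y) = D_(gam X) Y - Y' X].  As this trilinear form is symmetric,
   vanishes on eta by homogeneity, and is multiplied by [exp (2 sigma)] under the
   conformal change,
     (i)   D and Dt have the same vertical covariant derivatives,
     (ii)  [K (gam Y) = Y],
     (iii) [D_(gam X) Y - D_(gam Y) X = K [gam X, gam Y]].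
   From (ii), [Phat (X, Y) = - D_(bet X) Y + K [bet X, gam Y]], so that the
   Hashiguchi connection is
     [D*_X Y = D_(gam (K X)) Y + K [bet (rho X), gam Y]].
   Substituting [Kt = K + N rho] and [bett = bet - gam N] in the same formula for
   Dt, the difference is
     [D_(gam (N rho X)) Y + N rho [bet (rho X), gam Y] - K [gam (N rho X), gam Y]],
   which is omega* by (iii). *)
Require Import Defs.
From HB Require Import structures.
From mathcomp Require Import all_boot all_order all_algebra.
From mathcomp Require Import all_classical all_reals all_analysis.
(* mathcomp-analysis has a [proj] too *)
Import Defs.
Import Order.TTheory GRing.Theory Num.Theory numFieldNormedType.Exports.
Local Open Scope classical_set_scope.
Local Open Scope ring_scope.
Set Implicit Arguments.
Unset Strict Implicit.
Unset Printing Implicit Defensive.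

(** * Smooth maps *)

Section NearEq.
Context {R : realType} {V W : normedModType R}.
Implicit Types f g : V -> W.

(** The conformal factor involves the base point only, so it is constant on each fibre; this is why
    the vertical third derivative scales with it, and nondegeneracy of the metric then identifies
    the vertical derivatives of the two connections. Two obstacles shape the proof. A tangent vector
    is stored by its components in the chart preferred at its own base point, and this chart may
    jump from point to point: a section can be differentiated only after being read in one fixed
    chart, and all the calculus concerns germs of such readings. Moreover, the axioms of a
    connection and the formulas for Lie brackets concern smooth sections, so [bet Y] must be known
    to be smooth before the torsion is computed, hence before (ii) makes [bet] explicit. Regularity
    alone has to provide this, through a linear system with smooth invertible matrix; hence the
    calculus of determinants. *)

Lemma near0_differentiable f x : (\forall y \near x, f y = 0) -> differentiable f x.
Proof.
move=> f0.
have lin0 : linear (fun _ : V => 0 : W) by move=> a u v; rewrite scaler0 addr0.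
pose z : {linear V -> W} := HB.pack (fun _ : V => 0 : W)
  (GRing.isLinear.Build R V W _ _ lin0).
have zc : continuous z by move=> y; exact: cvg_cst.
have fx0 : f x = 0 := nbhs_singleton f0.
have E : f \o shift x = cst (f x) + z +o_ 0 id.
  apply/eqaddoP => _/posnumP[e]; near=> h.
  rewrite /= fx0; have -> : (f \o shift x - (cst 0 + z)) h = 0.
    rewrite -[LHS]/(f (h + x) - (0 + 0)) addr0 subr0.
    near: h; rewrite near_simpl.
    by move: f0; rewrite (near_shift 0) subr0.
  by rewrite normr0 mulr_ge0.
apply/diff_locallyP; rewrite (diff_unique zc E).
by split.
Unshelve. all: by end_near. Qed.

(** [rep] extends a map by 0 off the image of a chart, so readings of maps agree only near a point;
    differentiability has to be an invariant of the germ. *)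
Lemma near_eq_differentiable f g x : (\forall y \near x, f y = g y) ->
  differentiable f x -> differentiable g x.
Proof.
move=> fg df; have -> : g = f + (g - f) by apply/funext => y; rewrite !fctE addrC subrK.
apply: differentiableD => //; apply: near0_differentiable.
by near=> y; rewrite !fctE (near fg y)// subrr.
Unshelve. all: by end_near. Qed.

Lemma near_eq_diff f g x v : (\forall y \near x, f y = g y) ->
  differentiable f x -> 'd f x v = 'd g x v.
Proof.
move=> fg df; rewrite -(deriveE v df) -(deriveE v (near_eq_differentiable fg df)).
exact: near_eq_derive.
Qed.

(** The difference quotients coincide term by term. This carries derivatives through translations,
    dilations and the affine inclusions of fibres. *)
Lemma derive_comp_affine {U : normedModType R} (l : {linear U -> V}) b f u v :
  'D_v (fun w => f (l w + b)) u = 'D_(l v) f (l u + b).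
Proof.
rewrite /derive.
suff -> : (fun h : R => h^-1 *: (((fun w => f (l w + b)) \o shift u) (h *: v) -
    f (l u + b))) =
  (fun h : R => h^-1 *: ((f \o shift (l u + b)) (h *: l v) - f (l u + b))) by [].
apply/funext => h /=; congr (_ *: (f _ - _)).
by rewrite linearD linearZ addrA.
Qed.

End NearEq.

(** * Differentiability of finite order on an open set *)

Section Cn.
Context {R : realType}.
Implicit Types V W Z : normedModType R.

(** Iterated directional derivatives of length at most [n] are differentiable on [U]. The product
    and chain rules mix derivatives of all lower orders of the factors, so stability is proved by
    induction on [n] with [U] fixed. *)
Fixpoint Cn {V W} (n : nat) (U : set V) (f : V -> W) : Prop :=
  (forall y, U y -> differentiable f y) /\
  (if n is m.+1 then forall v, Cn m U (fun x => 'D_v f x) else True).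

Definition smooth_on {V W} (U : set V) (f : V -> W) := forall n, Cn n U f.

Lemma Cn_diff {V W} n (U : set V) (f : V -> W) y :
  Cn n U f -> U y -> differentiable f y.
Proof. by case: n => [|n] [fd _]; apply: fd. Qed.

Lemma CnW {V W} n (U : set V) (f : V -> W) : Cn n.+1 U f -> Cn n U f.
Proof.
elim: n f => [|n IH] f [fd fD]; split=> // v.
exact/IH/fD.
Qed.

Lemma CnS {V W} n (U U' : set V) (f : V -> W) : U' `<=` U -> Cn n U f -> Cn n U' f.
Proof.
move=> UU; elim: n f => [|n IH] f [fd fD]; split=> //.
- by move=> y /UU; apply: fd.
- by move=> y /UU; apply: fd.
by move=> v; apply: IH (fD v).
Qed.

Lemma iter_derive_rcons {V W} s v (f : V -> W) :
  iter_derive (rcons s v) f = iter_derive s (fun x => 'D_v f x).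
Proof. by rewrite /iter_derive foldr_rcons. Qed.

(** [Cn] peels off the derivative taken first, [iter_derive] the one taken last; hence the induction
    from the right end of the list. *)
Lemma smooth_onP {V W} (U : set V) (f : V -> W) :
  smooth_on U f <-> forall y, U y -> forall s, differentiable (iter_derive s f) y.
Proof.
split=> [fU y Uy s|fU n].
  elim/last_ind: s f fU => [|s v IH] f fU; first exact: Cn_diff (fU 0) Uy.
  by rewrite iter_derive_rcons; apply: IH => n; have [_ fD] := fU n.+1; apply: fD.
elim: n f fU => [|n IH] f fU; split=> //; try (by move=> y Uy; apply: (fU y Uy [::])).
by move=> v; apply: IH => y Uy s; rewrite -iter_derive_rcons; apply: fU.
Qed.

Lemma smooth_nearP {V W} (f : V -> W) x :
  smooth_near f x <-> exists U, [/\ open U, U x & smooth_on U f].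
Proof.
split=> [|[U [oU Ux /smooth_onP fU]]].
  rewrite /smooth_near -nbhs_nearE nbhsE => -[U [oU Ux] UP].
  by exists U; split => //; apply/smooth_onP => y /UP.
by rewrite /smooth_near -nbhs_nearE nbhsE; exists U.
Qed.

Lemma Cn_ext {V W} n (U : set V) (f g : V -> W) : open U ->
  (forall y, U y -> f y = g y) -> Cn n U f -> Cn n U g.
Proof.
move=> oU; have nE (f' g' : V -> W) y : U y -> (forall z, U z -> f' z = g' z) ->
    \forall z \near y, f' z = g' z.
  by move=> Uy fg; apply: filterS fg _; exact: open_nbhs_nbhs.
elim: n f g => [|n IH] f g fg [fd fD]; split=> //.
- by move=> y Uy; apply: near_eq_differentiable (nE _ _ _ Uy fg) (fd y Uy).
- by move=> y Uy; apply: near_eq_differentiable (nE _ _ _ Uy fg) (fd y Uy).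
move=> v; apply: IH (fD v) => y Uy; exact: near_eq_derive (nE _ _ _ Uy fg).
Qed.

Lemma Cn_cst {V W} n (U : set V) (c : W) : Cn n U (fun=> c).
Proof.
elim: n c => [|n IH] c; split=> //; try (by move=> y _; exact: differentiable_cst).
move=> v; by under eq_fun do rewrite derive_cst; apply: IH.
Qed.

Lemma CnD {V W} n (U : set V) (f g : V -> W) : open U ->
  Cn n U f -> Cn n U g -> Cn n U (fun x => f x + g x).
Proof.
move=> oU; elim: n f g => [|n IH] f g [fd fD] [gd gD]; split=> //.
- by move=> y Uy; apply: differentiableD; [apply: fd|apply: gd].
- by move=> y Uy; apply: differentiableD; [apply: fd|apply: gd].
move=> v; apply: Cn_ext (IH _ _ (fD v) (gD v)) => // y Uy.
by rewrite deriveD//; apply: diff_derivable; [apply: fd|apply: gd].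
Qed.

Lemma Cn_sum {V W} n (U : set V) (I : Type) (r : seq I) (f : I -> V -> W) : open U ->
  (forall i, Cn n U (f i)) -> Cn n U (fun x => \sum_(i <- r) f i x).
Proof.
move=> oU fU; elim: r => [|i r IH].
  by apply: Cn_ext (Cn_cst n U 0) => // y _; rewrite big_nil.
by apply: Cn_ext (CnD oU (fU i) IH) => // y _; rewrite big_cons.
Qed.

Lemma derive_linear {V W Z} (l : {linear W -> Z}) (f : V -> W) x v :
  continuous l -> differentiable f x -> 'D_v (fun y => l (f y)) x = l ('D_v f x).
Proof.
move=> lc fd; rewrite !deriveE//; last first.
  by apply: differentiable_comp => //; exact: linear_differentiable.
by rewrite diff_comp//= ?diff_lin//; exact: linear_differentiable.
Qed.

Lemma Cn_linear {V W Z} n (U : set V) (l : {linear W -> Z}) (f : V -> W) : open U ->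
  continuous l -> Cn n U f -> Cn n U (fun x => l (f x)).
Proof.
move=> oU lc; elim: n f => [|n IH] f [fd fD]; split=> //.
- move=> y Uy; apply: differentiable_comp; [exact: fd|exact: linear_differentiable].
- move=> y Uy; apply: differentiable_comp; [exact: fd|exact: linear_differentiable].
move=> v; apply: Cn_ext (IH _ (fD v)) => // y Uy.
by rewrite derive_linear//; exact: fd.
Qed.

Lemma deriveMd {V} (f g : V -> R) x v :
  differentiable f x -> differentiable g x ->
  'D_v (fun y => f y * g y) x = 'D_v f x * g x + f x * 'D_v g x.
Proof.
move=> fd gd; have /= E := deriveM (diff_derivable (v := v) fd) (diff_derivable (v := v) gd).
by rewrite -[LHS]/('D_v (f * g) x) E addrC [_ *: 'D_v f x]mulrC.
Qed.

Lemma CnM {V} n (U : set V) (f g : V -> R) : open U ->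
  Cn n U f -> Cn n U g -> Cn n U (fun x => f x * g x).
Proof.
move=> oU; elim: n f g => [|n IH] f g fU gU.
  by split=> // y Uy; apply: differentiableM; apply: Cn_diff Uy; eassumption.
have [[fd fD] [gd gD]] := (fU, gU); split.
  by move=> y Uy; apply: differentiableM; [apply: fd|apply: gd].
move=> v.
apply: Cn_ext (CnD oU (IH _ _ (fD v) (CnW gU)) (IH _ _ (CnW fU) (gD v))) => // y Uy.
by rewrite deriveMd//; [apply: fd|apply: gd].
Qed.

Lemma deriveZl {V W} (k : V -> R) (e : W) x v : differentiable k x ->
  'D_v (fun y => k y *: e) x = 'D_v k x *: e.
Proof.
move=> kd; rewrite !deriveE//; last exact: differentiableZl.
by rewrite (congr1 (fun h => h v) (diffZl e kd)).
Qed.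

Lemma CnZl {V W} n (U : set V) (k : V -> R) (e : W) : open U ->
  Cn n U k -> Cn n U (fun x => k x *: e).
Proof.
move=> oU; elim: n k => [|n IH] k [kd kD]; split=> //.
- by move=> y Uy; apply: differentiableZl; apply: kd.
- by move=> y Uy; apply: differentiableZl; apply: kd.
move=> v; apply: Cn_ext (IH _ (kD v)) => // y Uy.
by rewrite deriveZl//; exact: kd.
Qed.

End Cn.

(** * Bases with continuous coordinates and the chain rule *)

Record fin_basis (R : realType) (F : normedModType R) := Basis {
  bidx : finType;
  bvec : bidx -> F;
  bcoord : bidx -> {linear F -> R};
  bcoord_cont : forall k, continuous (bcoord k);
  bcoordE : forall x, x = \sum_k bcoord k x *: bvec k }.

Arguments bvec {R F} _ _.
Arguments bcoord {R F} _ _.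
Arguments bcoord_cont {R F} _ _.
Arguments bcoordE {R F} _ _.

Section Basis.
Context {R : realType}.
Implicit Types V W Z : normedModType R.

Lemma diff_basis {W Z} (b : fin_basis W) (f : W -> Z) x v : differentiable f x ->
  'D_v f x = \sum_k bcoord b k v *: 'D_(bvec b k) f x.
Proof.
move=> fd; rewrite deriveE// {1}[v](bcoordE b) linear_sum/=.
by apply: eq_bigr => k _; rewrite linearZ/= deriveE.
Qed.

Lemma Cn_basis {V W} n (b : fin_basis W) (U : set V) (f : V -> W) : open U ->
  (forall k, Cn n U (fun x => bcoord b k (f x))) -> Cn n U f.
Proof.
move=> oU fU.
apply: Cn_ext (Cn_sum (index_enum _) oU (fun k => CnZl (bvec b k) oU (fU k))) => // y _.
by rewrite [RHS](bcoordE b).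
Qed.

Lemma derive_comp {V W Z} (f : W -> Z) (g : V -> W) x v :
  differentiable g x -> differentiable f (g x) ->
  'D_v (fun y => f (g y)) x = 'D_('D_v g x) f (g x).
Proof.
move=> gd fd; rewrite !deriveE//; last exact: differentiable_comp.
by rewrite diff_comp.
Qed.

(** In the chain rule the direction ['D_v g x] moves with [x], whereas [Cn] speaks of fixed
    directions. Expanding it in a basis leaves products of scalar functions with derivatives of [f]
    along basis vectors, to which the induction applies. *)
Lemma Cn_comp_scalar {V W} n (b : fin_basis W) (U : set V) (U' : set W)
    (f : W -> R) (g : V -> W) : open U -> (forall y, U y -> U' (g y)) ->
  Cn n U g -> Cn n U' f -> Cn n U (fun x => f (g x)).
Proof.
move=> oU gUU'; elim: n f => [|n IH] f gU fU.
  split=> // y Uy; apply: differentiable_comp; first exact: Cn_diff gU Uy.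
  exact: Cn_diff fU (gUU' _ Uy).
have [[gd gD] [fd fD]] := (gU, fU); split.
  move=> y Uy; apply: differentiable_comp; first exact: gd.
  exact: fd (gUU' _ Uy).
move=> v.
have H k : Cn n U (fun x => bcoord b k ('D_v g x) * 'D_(bvec b k) f (g x)).
  apply: CnM => //; last exact: (IH _ (CnW gU) (fD (bvec b k))).
  exact: Cn_linear oU (bcoord_cont b k) (gD v).
apply: Cn_ext (Cn_sum (index_enum _) oU H) => // y Uy.
have gdy := gd _ Uy; have fdy := fd _ (gUU' _ Uy).
by rewrite (derive_comp v gdy fdy) (diff_basis b).
Qed.

Lemma Cn_comp {V W Z} n (bW : fin_basis W) (bZ : fin_basis Z) (U : set V) (U' : set W)
    (f : W -> Z) (g : V -> W) : open U -> open U' -> (forall y, U y -> U' (g y)) ->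
  Cn n U g -> Cn n U' f -> Cn n U (fun x => f (g x)).
Proof.
move=> oU oU' gUU' gU fU; apply: (Cn_basis (b := bZ)) => // k.
refine (Cn_comp_scalar bW oU gUU' gU (Cn_linear oU' (bcoord_cont bZ k) fU)).
Qed.

End Basis.

(** * Germs of smooth maps *)

Section SmoothNear.
Context {R : realType}.
Implicit Types V W Z : normedModType R.

Lemma smooth_near_ext {V W} (f g : V -> W) x : (\forall y \near x, f y = g y) ->
  smooth_near f x -> smooth_near g x.
Proof.
rewrite -nbhs_nearE nbhsE => -[B [oB Bx] fg] /smooth_nearP [U [oU Ux fU]].
apply/smooth_nearP; exists (B `&` U); split=> //; first exact: openI.
move=> n; apply: (Cn_ext (openI oB oU) _ (CnS (@subIsetr _ _ _) (fU n))).
by move=> y [/fg].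
Qed.

Lemma smooth_near_near {V W} (f : V -> W) x :
  smooth_near f x -> \forall y \near x, smooth_near f y.
Proof. exact: near_join. Qed.

Lemma smooth_near_differentiable {V W} (f : V -> W) x :
  smooth_near f x -> differentiable f x.
Proof. by move=> /nbhs_singleton /(_ [::]). Qed.

Lemma smooth_near_continuous {V W} (f : V -> W) x :
  smooth_near f x -> {for x, continuous f}.
Proof. by move=> /smooth_near_differentiable/differentiable_continuous. Qed.

Lemma smooth_near_derive {V W} (f : V -> W) x v :
  smooth_near f x -> smooth_near (fun y => 'D_v f y) x.
Proof.
move=> /smooth_nearP [U [oU Ux fU]]; apply/smooth_nearP; exists U; split=> // n.
by have [_ fD] := fU n.+1; apply: fD.
Qed.

Lemma smooth_near_cst {V W} (c : W) (x : V) : smooth_near (fun=> c) x.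
Proof.
by apply/smooth_nearP; exists setT; split; [exact: openT| |move=> n; exact: Cn_cst].
Qed.

Lemma smooth_nearD {V W} (f g : V -> W) x : smooth_near f x -> smooth_near g x ->
  smooth_near (fun y => f y + g y) x.
Proof.
move=> /smooth_nearP [U [oU Ux fU]] /smooth_nearP [U' [oU' Ux' gU']].
apply/smooth_nearP; exists (U `&` U'); split=> //; first exact: openI.
by move=> n; apply: CnD; [exact: openI|exact: CnS (fU n)|exact: CnS (gU' n)].
Qed.

Lemma smooth_nearM {V} (f g : V -> R) x : smooth_near f x -> smooth_near g x ->
  smooth_near (fun y => f y * g y) x.
Proof.
move=> /smooth_nearP [U [oU Ux fU]] /smooth_nearP [U' [oU' Ux' gU']].
apply/smooth_nearP; exists (U `&` U'); split=> //; first exact: openI.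
by move=> n; apply: CnM; [exact: openI|exact: CnS (fU n)|exact: CnS (gU' n)].
Qed.

Lemma smooth_near_linear_comp {V W Z} (l : {linear W -> Z}) (f : V -> W) x :
  continuous l -> smooth_near f x -> smooth_near (fun y => l (f y)) x.
Proof.
move=> lc /smooth_nearP [U [oU Ux fU]].
by apply/smooth_nearP; exists U; split=> // n; exact: Cn_linear.
Qed.

Lemma smooth_near_id {V} (x : V) : smooth_near (fun y : V => y) x.
Proof.
apply/smooth_nearP; exists setT; split=> //; first exact: openT.
case=> [|n]; split=> //; try (by move=> y _; apply: ex_diff).
by move=> v; under eq_fun do rewrite derive_id; exact: Cn_cst.
Qed.

Lemma smooth_near_linear {V W} (l : {linear V -> W}) (x : V) :
  continuous l -> smooth_near l x.
Proof. by move=> lc; exact: smooth_near_linear_comp (smooth_near_id x). Qed.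

Lemma smooth_near_sum {V W} (I : Type) (r : seq I) (f : I -> V -> W) x :
  (forall i, smooth_near (f i) x) -> smooth_near (fun y => \sum_(i <- r) f i y) x.
Proof.
move=> fx; elim: r => [|i r IH].
  apply: smooth_near_ext (smooth_near_cst 0 x); near=> y; by rewrite big_nil.
apply: smooth_near_ext (smooth_nearD (fx i) IH); near=> y; by rewrite big_cons.
Unshelve. all: by end_near. Qed.

Lemma smooth_nearZl {V W} (k : V -> R) (e : W) x :
  smooth_near k x -> smooth_near (fun y => k y *: e) x.
Proof.
move=> /smooth_nearP [U [oU Ux fU]].
by apply/smooth_nearP; exists U; split=> // n; exact: CnZl.
Qed.

Lemma smooth_near_basis {V W} (b : fin_basis W) (f : V -> W) x :
  (forall k, smooth_near (fun y => bcoord b k (f y)) x) -> smooth_near f x.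
Proof.
move=> fx.
have := smooth_near_sum (index_enum _) (fun k => smooth_nearZl (bvec b k) (fx k)).
by apply: smooth_near_ext; near=> y; rewrite [RHS](bcoordE b).
Unshelve. all: by end_near. Qed.

Lemma smooth_near_comp {V W Z} (bW : fin_basis W) (bZ : fin_basis Z) (f : W -> Z)
    (g : V -> W) x : smooth_near g x -> smooth_near f (g x) ->
  smooth_near (fun y => f (g y)) x.
Proof.
move=> gx; move: (smooth_near_continuous gx) => gc.
move: gx => /smooth_nearP [U [oU Ux gU]] /smooth_nearP [U' [oU' Ux' fU']].
have : nbhs x (g @^-1` U') by apply: gc; exact: open_nbhs_nbhs.
rewrite nbhsE => -[B [oB Bx] BU'].
apply/smooth_nearP; exists (U `&` B); split=> //; first exact: openI.
move=> n; have oUB := openI oU oB.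
refine (Cn_comp bW bZ oUB oU' _ (CnS (@subIsetl _ _ _) (gU n)) (fU' n)).
by move=> y [_ /BU'].
Qed.

Lemma smooth_nearN {V W} (f : V -> W) x : smooth_near f x ->
  smooth_near (fun y => - f y) x.
Proof.
move=> fx; have lin : linear (fun w : W => - w) by move=> a u v; rewrite opprD scalerN.
pose z : {linear W -> W} := HB.pack (fun w : W => - w)
  (GRing.isLinear.Build R W W _ _ lin).
by apply: (smooth_near_linear_comp (l := z)) => // y; exact: opp_continuous.
Qed.

(** Point and direction both vary, and the basis again makes the directions constant. Coordinate
    changes of vector fields and tangent lifts of transition maps have this form. *)
Lemma smooth_near_diff {V W Z} (bW : fin_basis W) (bZ : fin_basis Z) (f : W -> Z)
    (g h : V -> W) x : smooth_near g x -> smooth_near h x -> smooth_near f (g x) ->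
  smooth_near (fun y => 'd f (g y) (h y)) x.
Proof.
move=> gx hx fx; apply: (smooth_near_basis (b := bZ)) => k.
have H j : smooth_near
    (fun y => bcoord bW j (h y) * bcoord bZ k ('D_(bvec bW j) f (g y))) x.
  apply: smooth_nearM; first exact: smooth_near_linear_comp (bcoord_cont bW j) hx.
  have := smooth_near_comp bW bZ gx (smooth_near_derive (bvec bW j) fx).
  exact: smooth_near_linear_comp (bcoord_cont bZ k).
apply: smooth_near_ext (smooth_near_sum (index_enum _) H).
have gc := smooth_near_continuous gx.
have fg : nbhs x (g @^-1` [set w | differentiable f w]).
  apply: gc; apply: filterS (smooth_near_near fx).
  exact: smooth_near_differentiable.
near=> y; have fdy : differentiable f (g y) by near: y.
rewrite -deriveE// (diff_basis bW)//.
by rewrite linear_sum; apply: eq_bigr => j _; rewrite linearZ.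
Unshelve. all: by end_near. Qed.

End SmoothNear.

(** * Projections, inclusions and bases of products *)

Section LinearMaps.
Context {R : realType}.
Implicit Types V W Z : normedModType R.

Fact lfst_linear V W : linear (fun z : V * W => z.1).
Proof. by []. Qed.
Definition lfst V W : {linear (V * W)%type -> V} := HB.pack (fun z : V * W => z.1)
  (GRing.isLinear.Build R (V * W)%type V _ _ (@lfst_linear V W)).

Fact lsnd_linear V W : linear (fun z : V * W => z.2).
Proof. by []. Qed.
Definition lsnd V W : {linear (V * W)%type -> W} := HB.pack (fun z : V * W => z.2)
  (GRing.isLinear.Build R (V * W)%type W _ _ (@lsnd_linear V W)).

Fact linl_linear V W : linear (fun v : V => (v, 0 : W)).
Proof. by move=> a u v; apply: injective_projections => /=; rewrite ?scaler0 ?addr0. Qed.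
Definition linl V W : {linear V -> (V * W)%type} := HB.pack (fun v : V => (v, 0 : W))
  (GRing.isLinear.Build R V (V * W)%type _ _ (@linl_linear V W)).

Fact linr_linear V W : linear (fun w : W => (0 : V, w)).
Proof. by move=> a u v; apply: injective_projections => /=; rewrite ?scaler0 ?addr0. Qed.
Definition linr V W : {linear W -> (V * W)%type} := HB.pack (fun w : W => (0 : V, w))
  (GRing.isLinear.Build R W (V * W)%type _ _ (@linr_linear V W)).

Lemma lfst_continuous V W : continuous (lfst V W).
Proof. by move=> z; exact: cvg_fst. Qed.

Lemma lsnd_continuous V W : continuous (lsnd V W).
Proof. by move=> z; exact: cvg_snd. Qed.

Lemma linl_continuous V W : continuous (linl V W).
Proof. by move=> z; apply: cvg_pair; [exact: cvg_id|exact: cvg_cst]. Qed.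

Lemma linr_continuous V W : continuous (linr V W).
Proof. by move=> z; apply: cvg_pair; [exact: cvg_cst|exact: cvg_id]. Qed.

Lemma smooth_near_fst {V W Z} (f : V -> W * Z) x :
  smooth_near f x -> smooth_near (fun y => (f y).1) x.
Proof. exact: smooth_near_linear_comp (@lfst_continuous W Z). Qed.

Lemma smooth_near_snd {V W Z} (f : V -> W * Z) x :
  smooth_near f x -> smooth_near (fun y => (f y).2) x.
Proof. exact: smooth_near_linear_comp (@lsnd_continuous W Z). Qed.

Lemma smooth_near_pair {V W Z} (f : V -> W) (g : V -> Z) x :
  smooth_near f x -> smooth_near g x -> smooth_near (fun y => (f y, g y)) x.
Proof.
move=> fx gx.
have := smooth_nearD (smooth_near_linear_comp (@linl_continuous W Z) fx)
  (smooth_near_linear_comp (@linr_continuous W Z) gx).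
apply: smooth_near_ext; near=> y => /=.
by congr (_, _); rewrite /= ?addr0 ?add0r.
Unshelve. all: by end_near. Qed.

Section RV.
Variables (n : nat).
Fact rV_coord_linear (k : 'I_n) : linear (fun v : 'rV[R]_n => v ord0 k).
Proof. by move=> a u v; rewrite !mxE. Qed.
Definition rV_coord k : {linear 'rV[R]_n -> R} := HB.pack (fun v : 'rV[R]_n => v ord0 k)
  (GRing.isLinear.Build R 'rV[R]_n R _ _ (rV_coord_linear k)).

Definition rV_basis : fin_basis 'rV[R]_n.
Proof.
refine (@Basis R 'rV[R]_n 'I_n (fun k => delta_mx 0 k) rV_coord _ _).
  by move=> k; exact: coord_continuous.
exact: row_sum_delta.
Defined.
End RV.

Section Prod.
Variables (V W : normedModType R) (bV : fin_basis V) (bW : fin_basis W).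

Definition prod_coord (k : bidx bV + bidx bW) : {linear (V * W)%type -> R} :=
  match k with
  | inl i => (bcoord bV i \o lfst V W)
  | inr j => (bcoord bW j \o lsnd V W)
  end.

Definition prod_basis : fin_basis (V * W)%type.
Proof.
refine (@Basis R (V * W)%type (bidx bV + bidx bW)%type
  (fun k => match k with inl i => (bvec bV i, 0) | inr j => (0, bvec bW j) end)
  prod_coord _ _).
  case=> k z /=; apply: continuous_comp; try exact: bcoord_cont.
    exact: lfst_continuous.
  exact: lsnd_continuous.
case=> v w; rewrite big_sumType/=.
have -> : \sum_(i : bidx bV) bcoord bV i v *: (bvec bV i, 0 : W) = linl V W v.
  rewrite {2}[v](bcoordE bV) linear_sum; apply: eq_bigr => i _.
  by rewrite linearZ.
have -> : \sum_(i : bidx bW) bcoord bW i w *: (0 : V, bvec bW i) = linr V W w.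
  rewrite {2}[w](bcoordE bW) linear_sum; apply: eq_bigr => i _.
  by rewrite linearZ.
by congr (_, _); rewrite /= ?addr0 ?add0r.
Defined.
End Prod.

End LinearMaps.

(** * Symmetry of second derivatives *)

Section Schwarz.
Context {R : realType} {V : normedModType R}.
Implicit Types f : V -> R.

Lemma line_differentiable (p w : V) (t : R) : differentiable (fun s : R => p + s *: w) t.
Proof.
apply: differentiableD; first exact: differentiable_cst.
exact: differentiableZl.
Qed.

Lemma derive_line (p w : V) (t : R) : 'D_1 (fun s : R => p + s *: w) t = w.
Proof.
have -> : (fun s : R => p + s *: w) = cst p + (fun s => s *: w) by [].
rewrite deriveD; last 2 first.
- exact: derivable_cst.
- by apply: diff_derivable; exact: differentiableZl.
by rewrite derive_cst add0r (deriveZl (k := id))// derive_id scale1r.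
Qed.

Lemma line_MVT f (p w : V) (h : R) : 0 < h ->
  (forall t, 0 <= t <= h -> differentiable f (p + t *: w)) ->
  exists2 c, 0 <= c <= h & f (p + h *: w) - f p = h * 'D_w f (p + c *: w).
Proof.
move=> h0 fd; pose g (t : R) := f (p + t *: w).
have gd t : 0 <= t <= h -> differentiable g t.
  by move=> th; apply: differentiable_comp (line_differentiable p w t) (fd _ th).
have gD t : 0 <= t <= h -> 'D_1 g t = 'D_w f (p + t *: w).
  move=> th; rewrite (derive_comp (1 : R) (line_differentiable p w t) (fd _ th)).
  by rewrite derive_line.
have [t /itvP tI||c /itvP cI E] := @MVT R g (fun t => 'D_w f (p + t *: w)) 0 h h0.
- have tI' : 0 <= t <= h by rewrite !tI.
  by rewrite -gD//; apply: derivableP; apply: diff_derivable; apply: gd.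
- apply: derivable_within_continuous => t /itvP tI; apply: diff_derivable.
  by apply: gd; rewrite !tI.
exists c; first by rewrite !cI.
by move: E; rewrite /g scale0r addr0 subr0 mulrC.
Qed.

(** The mean value theorem is applied twice: to the increment of [f] along [h *: v], as the point
    moves along [w], then to ['D_w f] along [v]. *)
Lemma mixed_difference f (x v w : V) (h : R) : 0 < h ->
  (forall s t, 0 <= s <= h -> 0 <= t <= h -> differentiable f (x + s *: v + t *: w) /\
     differentiable (fun y => 'D_w f y) (x + s *: v + t *: w)) ->
  exists s t, [/\ 0 <= s <= h, 0 <= t <= h &
    f (x + h *: v + h *: w) - f (x + h *: v) - f (x + h *: w) + f x
      = h * (h * 'D_v (fun y => 'D_w f y) (x + s *: v + t *: w))].
Proof.
move=> h0 fd; have hI : 0 <= h <= h by rewrite ltW//=.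
have oI : (0 : R) <= 0 <= h by rewrite lexx ltW.
have gd t : 0 <= t <= h ->
    differentiable (fun y => f (y + h *: v)) (x + t *: w) /\
    differentiable f (x + t *: w).
  move=> tI; split; last first.
    by have [+ _] := fd 0 t oI tI; rewrite scale0r addr0.
  have [fdt _] := fd h t hI tI; rewrite addrAC in fdt.
  have sd : differentiable (fun y => y + h *: v) (x + t *: w) by apply: differentiableD.
  exact: (differentiable_comp sd fdt).
have [|c cI] := @line_MVT (fun y => f (y + h *: v) - f y) x w h h0.
  by move=> t /gd [? ?]; exact: differentiableB.
have [g1 g2] := gd c cI.
have DE : 'D_w (fun y => f (y + h *: v) - f y) (x + c *: w)
    = 'D_w f (x + c *: w + h *: v) - 'D_w f (x + c *: w).
  have := deriveB (diff_derivable (v := w) g1) (diff_derivable (v := w) g2).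
  by rewrite (derive_comp_affine idfun (h *: v)).
have [|d dI E2] := @line_MVT (fun y => 'D_w f y) (x + c *: w) v h h0.
  by move=> t tI; have [_] := fd t c tI cI; rewrite addrAC.
rewrite DE E2 => E1; exists d, c; split; [exact: dI|exact: cI|].
rewrite [x + d *: v + c *: w]addrAC -E1 [x + h *: w + h *: v]addrAC opprB addrA.
by rewrite addrAC [X in X + _ = _]addrAC.
Qed.

(** The second difference over a parallelogram is symmetric in [v] and [w], so the two mixed
    derivatives take a common value, each at some point of an arbitrarily small parallelogram;
    continuity at [x] concludes. *)
Lemma derive_sym f x v w : smooth_near f x ->
  'D_v (fun y => 'D_w f y) x = 'D_w (fun y => 'D_v f y) x.
Proof.
move=> fx; apply/eqP; rewrite -subr_eq0 -normr_le0; apply/ler_addgt0Pl => e e0.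
rewrite addr0.
pose a y := 'D_v (fun y => 'D_w f y) y; pose b y := 'D_w (fun y => 'D_v f y) y.
have e2 : 0 < e / 2 by rewrite divr_gt0.
have ac : \forall y \near x, `|a x - a y| < e / 2.
  have := smooth_near_continuous (smooth_near_derive v (smooth_near_derive w fx)).
  by move=> /cvgrPdist_lt /(_ _ e2).
have bc : \forall y \near x, `|b x - b y| < e / 2.
  have := smooth_near_continuous (smooth_near_derive w (smooth_near_derive v fx)).
  by move=> /cvgrPdist_lt /(_ _ e2).
have [r /= r0 rP] : exists2 r : R, 0 < r & forall y, `|x - y| < r ->
    [/\ smooth_near f y, `|a x - a y| < e / 2 & `|b x - b y| < e / 2].
  have /nbhs_ballP[r r0 rP] : nbhs x [set y |
      [/\ smooth_near f y, `|a x - a y| < e / 2 & `|b x - b y| < e / 2]].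
    by apply: filterS3 (smooth_near_near fx) ac bc => y; split.
  by exists r => // y xy; apply: rP; rewrite -ball_normE.
(* This keeps the whole parallelogram within [r] of [x]. The added 1 makes the denominator positive
   even when [v] and [w] vanish, and the bound strict. *)
pose h := r / (2 * (`|v| + `|w| + 1)).
have m0 : 0 < `|v| + `|w| + 1 by rewrite ltr_wpDl// addr_ge0.
have h0 : 0 < h by rewrite divr_gt0// mulr_gt0.
have near_x s t : 0 <= s <= h -> 0 <= t <= h -> `|x - (x + s *: v + t *: w)| < r.
  move=> /andP[s0 sh] /andP[t0 th]; rewrite -addrA opprD addrA subrr add0r normrN.
  apply: (le_lt_trans (ler_normD _ _)); rewrite !normrZ !ger0_norm//.
  apply: (@le_lt_trans _ _ (h * (`|v| + `|w|))).
    by rewrite mulrDr lerD// ler_wpM2r.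
  apply: (@lt_le_trans _ _ (h * (`|v| + `|w| + 1))).
    by rewrite ltr_pM2l// ltrDl.
  rewrite /h invfM mulrA mulfVK ?gt_eqF//.
  by rewrite ler_pdivrMr// ler_peMr ?ltW// ltr1n.
have dif v' w' : (forall s t, 0 <= s <= h -> 0 <= t <= h ->
    `|x - (x + s *: v' + t *: w')| < r) ->
  forall s t, 0 <= s <= h -> 0 <= t <= h -> differentiable f (x + s *: v' + t *: w') /\
     differentiable (fun y => 'D_w' f y) (x + s *: v' + t *: w').
  move=> nx s t sI tI; have [fy _ _] := rP _ (nx s t sI tI).
  by split; apply: smooth_near_differentiable => //; exact: smooth_near_derive.
have [s [t [sI tI E]]] := mixed_difference h0 (dif _ _ near_x).
have near_x' s' t' : 0 <= s' <= h -> 0 <= t' <= h ->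
    `|x - (x + s' *: w + t' *: v)| < r.
  by move=> sI' tI'; rewrite [x + _ + _]addrAC; exact: near_x.
have [s' [t' [sI' tI' E']]] := mixed_difference h0 (dif _ _ near_x').
have ab : a (x + s *: v + t *: w) = b (x + s' *: w + t' *: v).
  apply: (mulfI (lt0r_neq0 h0)); apply: (mulfI (lt0r_neq0 h0)).
  rewrite -E -E' [x + h *: w + _]addrAC; congr (_ + _).
  by rewrite -!addrA [- _ - _]addrC.
have [_ h1 _] := rP _ (near_x s t sI tI).
have [_ _ h2] := rP _ (near_x' s' t' sI' tI').
rewrite distrC in h2; rewrite -ab in h2.
have := lerD (ltW h1) (ltW h2); rewrite -splitr.
exact: le_trans (ler_distD _ _ _).
Qed.

End Schwarz.

(** * Inverses and Cramer's rule *)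

Section Inverse.
Context {R : realType} {V : normedModType R}.

Lemma CnV n (U : set V) (f : V -> R) : open U -> (forall y, U y -> f y != 0) ->
  Cn n U f -> Cn n U (fun x => (f x)^-1).
Proof.
move=> oU f0; elim: n => [|n IH] fU.
  by split=> // y Uy; apply: differentiableV; [exact: Cn_diff fU Uy|exact: f0].
have [fd fD] := fU; split.
  by move=> y Uy; apply: differentiableV; [exact: fd|exact: f0].
move=> v; have iU := IH (CnW fU).
have := CnM oU (CnM oU (CnZl (-1 : R) oU iU) iU) (fD v).
apply: Cn_ext => // y Uy.
have fdy : derivable f y v by apply: diff_derivable; exact: fd.
by rewrite (deriveV (f0 _ Uy) fdy) /GRing.scale /= mulrN1 mulNr -invfM -expr2.
Qed.

Lemma smooth_nearV (f : V -> R) x : f x != 0 -> smooth_near f x ->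
  smooth_near (fun y => (f y)^-1) x.
Proof.
move=> fx0 fx; have /cvgr_neq0 : f y @[y --> x] --> f x := smooth_near_continuous fx.
move=> /(_ fx0).
rewrite -nbhs_nearE nbhsE => -[B [oB Bx] f0].
move: fx => /smooth_nearP [U [oU Ux fU]].
apply/smooth_nearP; exists (U `&` B); split=> //; first exact: openI.
move=> n; apply: CnV; [exact: openI|by move=> y [_ /f0]|].
exact: CnS (@subIsetl _ _ _) (fU n).
Qed.

Lemma smooth_near_prod (I : Type) (r : seq I) (f : I -> V -> R) x :
  (forall i, smooth_near (f i) x) -> smooth_near (fun y => \prod_(i <- r) f i y) x.
Proof.
move=> fx; elim: r => [|i r IH].
  by apply: smooth_near_ext (smooth_near_cst (1 : R) x); near=> y; rewrite big_nil.
by apply: smooth_near_ext (smooth_nearM (fx i) IH); near=> y; rewrite big_cons.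
Unshelve. all: by end_near. Qed.

Lemma smooth_near_det m (f : V -> 'M[R]_m) x :
  (forall k l, smooth_near (fun y => f y k l) x) -> smooth_near (fun y => \det (f y)) x.
Proof.
move=> fx; apply: smooth_near_sum => s; apply: smooth_nearM; first exact: smooth_near_cst.
by apply: smooth_near_prod => k; exact: fx.
Qed.

Lemma smooth_near_adj m (f : V -> 'M[R]_m) x :
  (forall k l, smooth_near (fun y => f y k l) x) ->
  forall k l, smooth_near (fun y => (\adj (f y)) k l) x.
Proof.
move=> fx k l.
have := smooth_nearM (smooth_near_cst ((-1) ^+ (l + k) : R) x)
  (smooth_near_det (f := fun y => row' l (col' k (f y))) (x := x) _).
move=> H; apply: smooth_near_ext (H _); first by near=> y; rewrite mxE.
by move=> k' l'; apply: smooth_near_ext (fx (lift l k') (lift k l')); near=> y; rewrite !mxE.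
Unshelve. all: by end_near. Qed.

Lemma smooth_near_solve m (f : V -> 'M[R]_m) (b : V -> 'rV[R]_m) x :
  (forall k l, smooth_near (fun y => f y k l) x) -> smooth_near b x ->
  (f x) \in unitmx -> smooth_near (fun y => b y *m invmx (f y)) x.
Proof.
move=> fx bx ux; have dx := smooth_near_det fx.
have d0 : \det (f x) != 0 by move: ux; rewrite unitmxE unitfE.
apply: (smooth_near_basis (b := rV_basis m)) => l.
have bxl k : smooth_near (fun y => b y ord0 k) x.
  exact: smooth_near_linear_comp (bcoord_cont (rV_basis m) k) bx.
have H k : smooth_near (fun y => b y ord0 k * ((\det (f y))^-1 * (\adj (f y)) k l)) x.
  apply: smooth_nearM; first exact: bxl.
  apply: smooth_nearM; first exact: smooth_nearV.
  exact: smooth_near_adj.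
apply: smooth_near_ext (smooth_near_sum (index_enum _) H).
(* [invmx] is given by the adjugate only where the determinant is nonzero, which continuity ensures
   near [x]. *)
have un : \forall y \near x, \det (f y) != 0.
  exact: cvgr_neq0 (smooth_near_continuous dx) d0.
near=> y; have uy : \det (f y) != 0 by near: y.
rewrite /= [RHS]mxE; apply: eq_bigr => k _.
by rewrite /invmx unitmxE unitfE uy [in RHS]mxE.
Unshelve. all: by end_near. Qed.

End Inverse.

(** Only the restriction of [f] to a line matters; there [f] is affine and the difference quotient
    is constant for [h] nonzero. *)
Lemma derive_eq_line (R : realType) (V W : normedModType R) (f : V -> W) (a v : V) (c : W) :
  (forall h : R, f (h *: v + a) = h *: c + f a) -> 'D_v f a = c.
Proof.
move=> fE; rewrite /derive; apply: cvg_lim => //.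
have cc : (fun h : R => c) @ 0^' --> c by exact: cvg_cst.
apply: cvg_trans cc; apply: near_eq_cvg; near=> h.
have h0 : h != 0 by near: h; exact: nbhs_dnbhs_neq.
by rewrite /= fE addrK scalerA mulVf// scale1r.
Unshelve. all: by end_near. Qed.

Definition scalar_basis (R : realType) : fin_basis R.
Proof.
refine (@Basis R R unit (fun=> 1) (fun=> idfun) _ _); first by move=> k x; exact: cvg_id.
by move=> x; rewrite big_const card_unit /= addr0 [x *: 1]mulr1.
Defined.

(** * Leibniz rule for a Hessian *)

Section Hessian.
Context {R : realType}.
Implicit Types V W : normedModType R.

Lemma derive_bigsum V W (I : Type) (r : seq I) (f : I -> V -> W) x v :
  (forall i, differentiable (f i) x) ->
  differentiable (fun y => \sum_(i <- r) f i y) x /\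
  'D_v (fun y => \sum_(i <- r) f i y) x = \sum_(i <- r) 'D_v (f i) x.
Proof.
move=> fd; elim: r => [|i r [IHd IHD]].
  have -> : (fun y => \sum_(i <- [::]) f i y) = cst 0 by apply/funext => y; rewrite big_nil.
  by rewrite big_nil derive_cst; split=> //; exact: differentiable_cst.
have -> : (fun y => \sum_(j <- i :: r) f j y) = f i + (fun y => \sum_(j <- r) f j y).
  by apply/funext => y; rewrite big_cons.
split; first exact: differentiableD.
by rewrite big_cons deriveD ?IHD//; exact: diff_derivable.
Qed.

Variables (V E : normedModType R) (bE : fin_basis E) (l : {linear E -> V}).
Variables (F : V -> R).

(** [l] will be the inclusion [linr] of the fibre directions. With [F] the energy read in a chart,
    this is the metric as a function of all the coordinates of the slit bundle. *)
Definition hess z a b : R := 'D_(l a) (fun z' => 'D_(l b) F z') z.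

Lemma hessC z a b : smooth_near F z -> hess z a b = hess z b a.
Proof. exact: derive_sym. Qed.

Lemma hess_sum z a b : smooth_near F z ->
  hess z a b = \sum_k bcoord bE k a * hess z (bvec bE k) b.
Proof.
move=> Fz; have Fd := smooth_near_differentiable (smooth_near_derive (l b) Fz).
rewrite /hess deriveE// {1}[a](bcoordE bE) linear_sum linear_sum.
by apply: eq_bigr => k _; rewrite !linearZ/= -deriveE.
Qed.

Lemma hess_expand z a b : smooth_near F z -> hess z a b =
  \sum_k \sum_j bcoord bE k a * (bcoord bE j b * hess z (bvec bE k) (bvec bE j)).
Proof.
move=> Fz; rewrite hess_sum//; apply: eq_bigr => k _.
rewrite hessC// hess_sum// mulr_sumr; apply: eq_bigr => j _.
by rewrite hessC.
Qed.

Lemma hess_smooth (Y Z : V -> E) z : smooth_near F z ->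
  smooth_near Y z -> smooth_near Z z -> smooth_near (fun z' => hess z' (Y z') (Z z')) z.
Proof.
move=> Fz Ys Zs.
have H k j : smooth_near (fun z' => bcoord bE k (Y z') *
    (bcoord bE j (Z z') * hess z' (bvec bE k) (bvec bE j))) z.
  apply: smooth_nearM; first exact: smooth_near_linear_comp (bcoord_cont bE k) Ys.
  apply: smooth_nearM; first exact: smooth_near_linear_comp (bcoord_cont bE j) Zs.
  by apply: smooth_near_derive; exact: smooth_near_derive.
have H' k := smooth_near_sum (index_enum (bidx bE)) (H k).
apply: smooth_near_ext (smooth_near_sum (index_enum (bidx bE)) H').
by apply: filterS (smooth_near_near Fz) => z' Fz'; rewrite [RHS]hess_expand.
Qed.

Lemma derive_hess (Y Z : V -> E) z X : smooth_near F z ->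
  differentiable Y z -> differentiable Z z ->
  'D_X (fun z' => hess z' (Y z') (Z z')) z
  = 'D_X (fun z' => hess z' (Y z) (Z z)) z
    + (hess z ('D_X Y z) (Z z) + hess z (Y z) ('D_X Z z)).
Proof.
move=> Fz Yd Zd; have Fn := smooth_near_near Fz.
pose H k j z' := hess z' (bvec bE k) (bvec bE j).
have Hd k j : differentiable (H k j) z.
  apply: smooth_near_differentiable; apply: smooth_near_derive.
  exact: smooth_near_derive.
have cd (U : V -> E) k : differentiable U z -> differentiable (fun z => bcoord bE k (U z)) z.
  move=> Ud; apply: differentiable_comp Ud _.
  exact: linear_differentiable (bcoord_cont bE k).
(* Used twice: for [Y] and [Z], and for the constant sections with the same values at [z], where
   only the terms differentiating the Hessian survive. *)
have key (U U' : V -> E) u u' : differentiable U z -> differentiable U' z ->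
    'D_X U z = u -> 'D_X U' z = u' -> 'D_X (fun z' => hess z' (U z') (U' z')) z =
    \sum_k \sum_j (bcoord bE k u * (bcoord bE j (U' z) * H k j z) +
      bcoord bE k (U z) * (bcoord bE j u' * H k j z +
         bcoord bE j (U' z) * 'D_X (H k j) z)).
  move=> Ud Ud' <- <-.
  pose G k j z' := bcoord bE k (U z') * (bcoord bE j (U' z') * H k j z').
  have Gd' k j : differentiable (fun z' => bcoord bE j (U' z') * H k j z') z.
    by apply: differentiableM; [exact: cd|exact: Hd].
  have Gd k j : differentiable (G k j) z.
    by apply: differentiableM; [exact: cd|exact: Gd'].
  have GE : \forall z' \near z, hess z' (U z') (U' z') = \sum_k \sum_j G k j z'.
    by apply: filterS Fn => z' Fz'; exact: hess_expand.
  refine (etrans (near_eq_derive X GE) _).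
  have S1 k := derive_bigsum (index_enum (bidx bE)) X (Gd k).
  have [_ ->] := derive_bigsum (index_enum (bidx bE)) X (fun k => (S1 k).1).
  apply: eq_bigr => k _; rewrite (S1 k).2; apply: eq_bigr => j _.
  have GD := deriveMd X (cd U k Ud) (Gd' k j).
  refine (etrans GD _).
  rewrite (deriveMd X (cd U' j Ud') (Hd k j)).
  by rewrite (derive_linear X (bcoord_cont bE k) Ud) (derive_linear X (bcoord_cont bE j) Ud').
have cst_d (e : E) : differentiable (fun _ : V => e) z by exact: differentiable_cst.
have K1 := key Y Z _ _ Yd Zd erefl erefl.
have K2 := key _ _ _ _ (cst_d (Y z)) (cst_d (Z z)) (derive_cst _ _ _) (derive_cst _ _ _).
refine (etrans K1 (esym _)); refine (etrans (congr1 (fun t => t + _) K2) _).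
rewrite !(hess_expand _ _ Fz) -!big_split; apply: eq_bigr => k _ /=.
rewrite -!big_split; apply: eq_bigr => j _ /=.
rewrite !linear0 !mul0r !add0r mulrDr.
have alg (p q r : R) : p + (q + r) = q + (r + p) by rewrite addrC addrA.
exact: alg.
Qed.

End Hessian.

(** * Derivatives of homogeneous functions *)

Section HomogeneousDerivative.
Context {R : realType} {V : normedModType R} (f : V -> R).
Hypothesis fs : forall y, y != 0 -> smooth_near f y.

(** The map sending [y] to [f (t *: y)] is differentiated by the chain rule and by homogeneity; a
    factor [t] cancels. *)
Lemma derive_homogeneous (k : nat) (v : V) :
  (forall y (t : R), y != 0 -> 0 < t -> f (t *: y) = t ^+ k.+1 * f y) ->
  forall y (t : R), y != 0 -> 0 < t -> 'D_v f (t *: y) = t ^+ k * 'D_v f y.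
Proof.
move=> fh y t y0 t0; have ty0 : t *: y != 0 by rewrite scaler_eq0 negb_or gt_eqF.
apply: (mulfI (lt0r_neq0 t0)); rewrite mulrA -exprS.
have D1 : 'D_v (fun y => f ((t \*: idfun) y + 0)) y = t * 'D_v f (t *: y).
  rewrite derive_comp_affine /= addr0 !deriveE ?linearZ//;
    by apply: smooth_near_differentiable; exact: fs.
have near0 : \forall y' \near y, y' != 0 by exact: cvgr_neq0 cvg_id y0.
have D2 : 'D_v (fun y => f ((t \*: idfun) y + 0)) y
    = 'D_v (fun y => t ^+ k.+1 *: f y) y.
  by apply: near_eq_derive; apply: filterS near0 => y' y'0; rewrite /= addr0 fh.
have fd : derivable f y v.
  by apply: diff_derivable; apply: smooth_near_differentiable; exact: fs.
refine (etrans (esym D1) (etrans D2 _)); exact: (deriveZ _ fd).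
Qed.

(** Euler's identity in degree 0: [f] is constant along [y + s *: y], a positive multiple of [y] as
    long as [-1 < s]. *)
Lemma derive_radial : (forall y (t : R), y != 0 -> 0 < t -> f (t *: y) = f y) ->
  forall y, y != 0 -> 'D_y f y = 0.
Proof.
move=> fh y y0; have fd := smooth_near_differentiable (fs y0).
have fd' : differentiable f (y + 0 *: y) by rewrite scale0r addr0.
have := derive_comp (1 : R) (line_differentiable y y 0) fd'.
rewrite derive_line scale0r addr0 => <-.
refine (etrans (@near_eq_derive _ _ _ _ (fun=> f y) (0 : R) (1 : R) _) (derive_cst _ _ _)).
have : \forall s \near (0 : R), -1 < s.
  by apply: lt_nbhsr; rewrite oppr_lt0.
apply: filterS => s s1; rewrite -[X in X + _]scale1r -scalerDl fh//.
by rewrite -ltrBlDl sub0r.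
Qed.

End HomogeneousDerivative.

(** * Atlases *)

Section Atlas.
Context {R : realType} {N : Type} {F : normedModType R} (B : charts N F).

(** What [M] and its slit bundle have in common. [charts] puts no topology on [N], so openness of
    overlaps is expressed in coordinates, by [atlas_near]. *)
Record atlas : Prop := Atlas {
  atlas_pref : forall p, dom (pref B p) p;
  atlas_fwdK : forall (i : idx B) p, dom i p -> bwd i (fwd i p) = Some p;
  atlas_near : forall (i j : idx B) p, dom i p -> dom j p ->
    \forall x \near fwd i p, exists q, [/\ dom i q, dom j q & fwd i q = x];
  atlas_transition : forall (i j : idx B) p, dom i p -> dom j p ->
    smooth_near (rep i (fwd j)) (fwd i p) }.

Hypothesis aB : atlas.
Implicit Types (i j : idx B) (p q : N) (W : normedModType R).

Lemma rep_fwd W i (f : N -> W) p : dom i p -> rep i f (fwd i p) = f p.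
Proof. by move=> ip; rewrite /rep atlas_fwdK. Qed.

Lemma near_fwd i j p (P : F -> Prop) : dom i p -> dom j p ->
  (forall q, dom i q -> dom j q -> P (fwd i q)) -> \forall x \near fwd i p, P x.
Proof.
move=> ip jp PP; apply: filterS (atlas_near aB ip jp) => x [q [iq jq <-]].
exact: PP.
Qed.

Lemma rep_near_eq W i (f g : N -> W) p : dom i p ->
  (forall q, dom i q -> f q = g q) ->
  \forall x \near fwd i p, rep i f x = rep i g x.
Proof.
move=> ip fg; apply: (near_fwd ip ip) => q iq _.
by rewrite !rep_fwd// fg.
Qed.

Lemma rep_change W i j (f : N -> W) p : dom i p -> dom j p ->
  \forall x \near fwd j p, rep j f x = rep i f (rep j (fwd i) x).
Proof.
move=> ip jp; apply: (near_fwd jp ip) => q jq iq.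
by rewrite !rep_fwd.
Qed.

Lemma rep_smooth_change W (bF : fin_basis F) (bW : fin_basis W) i j (f : N -> W) p :
  dom i p -> dom j p ->
  smooth_near (rep i f) (fwd i p) -> smooth_near (rep j f) (fwd j p).
Proof.
move=> ip jp fx.
have := smooth_near_comp bF bW (f := rep i f) (atlas_transition aB jp ip).
rewrite rep_fwd// => /(_ fx); apply: smooth_near_ext.
by apply: filterS (rep_change f ip jp) => x ->.
Qed.

Lemma diff_rep_change W i j (f : N -> W) p v : dom i p -> dom j p ->
  differentiable (rep j f) (fwd j p) ->
  'd (rep i f) (fwd i p) v
    = 'd (rep j f) (fwd j p) ('d (rep i (fwd j)) (fwd i p) v).
Proof.
move=> ip jp fd.
have td := smooth_near_differentiable (atlas_transition aB ip jp).
have fd' : differentiable (rep j f) (rep i (fwd j) (fwd i p)) by rewrite rep_fwd.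
have /= E := near_eq_diff (g := rep i f) v _ (differentiable_comp td fd').
rewrite -E; last by apply: filterS (rep_change f jp ip) => x ->.
by rewrite diff_comp//= rep_fwd.
Qed.

Lemma diff_rep_id i p v : dom i p -> 'd (rep i (fwd i)) (fwd i p) v = v.
Proof.
move=> ip; rewrite -(@near_eq_diff _ _ _ id).
- by rewrite diff_val.
- by apply: (near_fwd ip ip) => q iq _; rewrite rep_fwd.
- exact: ex_diff.
Qed.

Lemma tcoord_pref p v : tcoord (pref B p) p v = v.
Proof. by apply: diff_rep_id; exact: atlas_pref. Qed.

Lemma tdiff_chart W i (f : N -> W) p v : dom i p ->
  differentiable (rep i f) (fwd i p) ->
  tdiff B p f v = 'd (rep i f) (fwd i p) (tcoord i p v).
Proof. by move=> ip fd; apply: diff_rep_change => //; exact: atlas_pref. Qed.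

Lemma tcoord_change i j p v : dom i p -> dom j p ->
  tcoord j p v = 'd (rep i (fwd j)) (fwd i p) (tcoord i p v).
Proof.
move=> ip jp; apply: tdiff_chart => //.
exact: smooth_near_differentiable (atlas_transition aB ip jp).
Qed.

(** Inverse of [tcoord i p]: the tangent vector at [p] whose components in the chart [i] are [e], as
    in [tangent_bwd]. *)
Definition tvec i p (e : F) : F := 'd (rep i (fwd (pref B p))) (fwd i p) e.

Lemma tcoord_tvec i j p e : dom i p -> dom j p ->
  tcoord j p (tvec i p e) = 'd (rep i (fwd j)) (fwd i p) e.
Proof.
move=> ip jp; have pp := atlas_pref aB p.
rewrite /tcoord /tdiff /tvec -diff_rep_change//.
exact: smooth_near_differentiable (atlas_transition aB pp jp).
Qed.

Lemma tvecK i p e : dom i p -> tcoord i p (tvec i p e) = e.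
Proof. by move=> ip; rewrite tcoord_tvec// diff_rep_id. Qed.

Lemma tcoordK i p v : dom i p -> tvec i p (tcoord i p v) = v.
Proof.
by move=> ip; rewrite -[RHS](tcoord_pref p) (tcoord_change v ip (atlas_pref aB p)).
Qed.

(** Changing charts applies the differential of a transition map, at a moving point, to the
    components; [smooth_near_diff] covers this. *)
Lemma vsmooth_at_chart (bF : fin_basis F) i (X : N -> F) p : dom i p ->
  smooth_near (rep i (field_comp i X)) (fwd i p) -> vsmooth_at B X p.
Proof.
move=> ip Xs j jp; apply: (rep_smooth_change bF bF ip jp).
have := smooth_near_diff bF bF (f := rep i (fwd j)) (smooth_near_id (fwd i p)) Xs
  (atlas_transition aB ip jp).
apply: smooth_near_ext; apply: (near_fwd ip jp) => q iq jq.
by rewrite !rep_fwd// [RHS](tcoord_change (X q) iq jq).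
Qed.

Lemma vsmooth_tvec (bF : fin_basis F) i (c : N -> F) p : dom i p ->
  smooth_near (rep i c) (fwd i p) -> vsmooth_at B (fun q => tvec i q (c q)) p.
Proof.
move=> ip cs; apply: (vsmooth_at_chart bF ip); apply: smooth_near_ext cs.
by apply: rep_near_eq => // q iq; rewrite /field_comp tvecK.
Qed.

End Atlas.

(** * The bundle of nonzero tangent vectors *)

Section SlitAtlas.
Context {R : realType} {n : nat} {M : topologicalType}.
Local Notation E := 'rV[R]_n.
Variable A : charts M E.
Hypothesis hM : smooth_manifold A.
Local Notation S := (slit_charts A).
Local Notation bE := (@rV_basis R n).
Local Notation bEE := (prod_basis bE bE).
Implicit Types (i j : idx A) (p q : M) (u w : @slit R n M).

Lemma manifold_atlas : atlas A.
Proof.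
split; [exact: mfd_pref hM|exact: mfd_fwdK hM| |exact: mfd_transition hM].
move=> i j p ip jp.
have oU : open (fwd i @` (dom i `&` dom j)).
  apply: (mfd_open_map hM); last exact: subIsetl.
  by apply: openI; exact: mfd_open hM _.
have : nbhs (fwd i p) (fwd i @` (dom i `&` dom j)).
  by apply: open_nbhs_nbhs; split=> //; exists p.
by apply: filterS => x [q [iq jq] qx]; exists q.
Qed.
Let aA := manifold_atlas.

Lemma slit_bwd i p e (ip : dom i p) (e0 : tvec i p e != 0) :
  bwd (c := S) i (fwd i p, e) = Some (exist _ (p, tvec i p e) e0).
Proof.
rewrite /= /tangent_bwd /= (atlas_fwdK aA)//=.
by rewrite insubT.
Qed.

Lemma tvec_neq0 i p e : dom i p -> e != 0 -> tvec i p e != 0.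
Proof.
move=> ip; apply: contra_neq => e0.
by rewrite -(tvecK aA e ip) e0 /tcoord /tdiff linear0.
Qed.

Lemma slit_fwdE i u : fwd (c := S) i u = (fwd i (proj u), tcoord i (proj u) (val u).2).
Proof. by []. Qed.

(** A slit chart maps onto pairs of a point in the image of a chart of [M] and a nonzero vector.
    Both conditions are open. *)
Lemma slit_near i j u : dom (c := S) i u -> dom (c := S) j u ->
  \forall z \near fwd (c := S) i u,
    exists w, [/\ dom (c := S) i w, dom (c := S) j w & fwd (c := S) i w = z].
Proof.
move=> iu ju; have v0 : tcoord i (proj u) (val u).2 != 0.
  apply: contra_neq (valP u) => v0.
  by rewrite -(tcoordK aA (val u).2 iu) v0 /tvec linear0.
have near1 : \forall z \near fwd (c := S) i u,
    exists q, [/\ dom i q, dom j q & fwd i q = z.1].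
  have c1 := @lfst_continuous R E E (fwd (c := S) i u).
  by apply: (c1 _ (atlas_near aA iu ju)).
have near2 : \forall z \near fwd (c := S) i u, z.2 != 0.
  exact: cvgr_neq0 (@lsnd_continuous R E E (fwd (c := S) i u)) v0.
apply: filterS2 near1 near2 => -[x v] /= [q [iq jq <-]] e0.
exists (exist _ (q, tvec i q v) (tvec_neq0 iq e0)); split=> //.
by rewrite /= /tangent_fwd /= (tvecK aA).
Qed.

Lemma slit_fwdK i u : dom (c := S) i u -> bwd (c := S) i (fwd (c := S) i u) = Some u.
Proof.
move=> iu; have e0 : tvec i (proj u) (tcoord i (proj u) (val u).2) != 0.
  by rewrite tcoordK//; exact: valP u.
rewrite slit_fwdE (slit_bwd iu e0); congr Some; apply: val_inj => /=.
by rewrite tcoordK// /proj -surjective_pairing.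
Qed.

(** The tangent lift of a transition map: a closed form of the coordinate change, visibly linear in
    the fibre variable. *)
Definition slit_transition i j (z : E * E) : E * E :=
  (rep i (fwd j) z.1, 'd (rep i (fwd j)) (z.1) z.2).

Lemma slit_transitionE i j u : dom (c := S) i u -> dom (c := S) j u ->
  fwd (c := S) j u = slit_transition i j (fwd (c := S) i u).
Proof.
move=> iu ju; rewrite slit_fwdE /slit_transition /= (rep_fwd aA)//.
by rewrite [X in (_, X)](tcoord_change aA _ iu ju).
Qed.

Lemma slit_transition_smooth i j u : dom (c := S) i u -> dom (c := S) j u ->
  smooth_near (slit_transition i j) (fwd (c := S) i u).
Proof.
move=> iu ju; have ts := atlas_transition aA iu ju.
have s1 := smooth_near_fst (smooth_near_id (fwd (c := S) i u)).
have s2 := smooth_near_snd (smooth_near_id (fwd (c := S) i u)).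
apply: smooth_near_pair; first refine (smooth_near_comp bE bE (f := rep i (fwd j)) s1 ts).
exact: (smooth_near_diff bE bE s1 s2 ts).
Qed.

Lemma slit_atlas : atlas S.
Proof.
split; [|exact: slit_fwdK|exact: slit_near|].
  by move=> u; exact: mfd_pref hM _.
move=> i j u iu ju; apply: smooth_near_ext (slit_transition_smooth iu ju).
apply: filterS (slit_near iu ju) => z [w [iw jw <-]].
by rewrite /rep slit_fwdK// -(slit_transitionE iw jw).
Qed.

Let aS := slit_atlas.

Lemma slit_rep_transition i j u : dom (c := S) i u -> dom (c := S) j u ->
  \forall z \near fwd (c := S) i u,
    slit_transition i j z = rep (A := S) i (fwd (c := S) j) z.
Proof.
move=> iu ju; apply: (near_fwd aS iu ju) => w iw jw.
by rewrite (rep_fwd aS)// (slit_transitionE iw jw).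
Qed.

Lemma slit_tcoordE i u (w : E * E) : dom i (proj u) ->
  tcoord (A := S) i u w
    = 'd (slit_transition (pref A (proj u)) i) (fwd (c := S) (pref A (proj u)) u) w.
Proof.
move=> iu; have pu : dom (c := S) (pref A (proj u)) u by exact: mfd_pref hM _.
apply/esym/near_eq_diff; first exact: slit_rep_transition.
by apply: smooth_near_differentiable; exact: slit_transition_smooth.
Qed.

(** The base component of the tangent lift depends on the base coordinates alone, so its Jacobian is
    block triangular. *)
Lemma slit_tcoord1 i u (w : E * E) : dom i (proj u) ->
  (tcoord (A := S) i u w).1 = tcoord i (proj u) w.1.
Proof.
move=> iu; have pu : dom (c := S) (pref A (proj u)) u by exact: mfd_pref hM _.
rewrite slit_tcoordE//.
set z := fwd _ u; set G := slit_transition _ _.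
have Gd : differentiable G z.
  by apply: smooth_near_differentiable; exact: slit_transition_smooth.
have td : differentiable (rep (pref A (proj u)) (fwd i)) z.1.
  by apply: smooth_near_differentiable; exact: atlas_transition aA _ _ _ pu iu.
have fd : differentiable (fun z : E * E => z.1) z.
  by apply: (linear_differentiable (f := lfst E E)); exact: lfst_continuous.
rewrite -deriveE// -[LHS](derive_linear (l := lfst E E) w _ Gd); last exact: lfst_continuous.
rewrite (derive_comp w fd td) deriveE//; congr ('d _ _ _).
rewrite deriveE//.
exact: (congr1 (fun h => h w) (diff_lin z (@lfst_continuous R E E))).
Qed.

(** The tangent lift is linear on each fibre, so its difference quotient along a vertical line is
    exact. *)
Lemma slit_tcoord_vertical i u (e : E) : dom i (proj u) ->
  tcoord (A := S) i u (0, e) = (0, tcoord i (proj u) e).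
Proof.
move=> iu; have pu : dom (c := S) (pref A (proj u)) u by exact: mfd_pref hM _.
rewrite slit_tcoordE// -deriveE; last first.
  by apply: smooth_near_differentiable; exact: slit_transition_smooth.
apply: derive_eq_line => h; rewrite /slit_transition /=.
rewrite scaler0 add0r linearD linearZ.
by apply: injective_projections => /=; rewrite ?scaler0 ?add0r.
Qed.

End SlitAtlas.

(** * Pi-vector fields, vertical and horizontal lifts *)

Section Fields.
Context {R : realType} {n : nat} {M : topologicalType}.
Local Notation E := 'rV[R]_n.
Variable A : charts M E.
Hypothesis hM : smooth_manifold A.
Local Notation S := (slit_charts A).
Local Notation bE := (@rV_basis R n).
Local Notation bEE := (prod_basis bE bE).
Implicit Types (i j : idx A) (p q : M) (u w : @slit R n M).
Implicit Types (Y Z : @slit R n M -> E) (X : @slit R n M -> E * E).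
Let aA := manifold_atlas hM.
Let aS := slit_atlas hM.

Definition pi_comp i Y : slit -> E := fun w => tcoord i (proj w) (Y w).

Lemma dom_pref u : dom (c := S) (pref A (proj u)) u.
Proof. exact: mfd_pref hM _. Qed.

(** [slit_charts] prefers at [u] the chart preferred at [proj u], so [proj] reads as the first
    projection of pairs. *)
Lemma tmap_proj u (w : E * E) : tmap S A proj u w = w.1.
Proof.
have du := dom_pref u.
rewrite /tmap /tdiff -(@near_eq_diff _ _ _ (lfst E E)).
- by rewrite (diff_lin _ (@lfst_continuous R E E)).
- by apply: (near_fwd aS du du) => v dv _; rewrite (rep_fwd aS).
- exact: linear_differentiable (@lfst_continuous R E E).
Qed.

Lemma rhoE X u : rho A X u = (X u).1.
Proof. exact: tmap_proj. Qed.

Lemma gamE Y u : gam A Y u = (0, Y u).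
Proof.
rewrite /gam derive1E; apply: derive_eq_line => h.
have tl := tcoord_pref aA; rewrite /tangent_fwd /= !tl.
rewrite addr0 scale0r addr0.
apply: injective_projections => /=; first by rewrite scaler0 add0r.
by rewrite addrC [h *: 1]mulr1.
Qed.

Lemma tcoord_inj i p : dom i p -> injective (tcoord i p).
Proof. by move=> ip; apply: can_inj => e; exact: tcoordK. Qed.

Lemma pi_smooth_rho X u : vsmooth_at S X u -> pi_smooth_at A (rho A X) u.
Proof.
move=> Xs i iu; apply: smooth_near_ext (smooth_near_fst (Xs i iu)).
apply: (near_fwd aS iu iu) => w iw _.
by rewrite !(rep_fwd aS)// /field_comp slit_tcoord1// rhoE.
Qed.

Lemma vsmooth_gam Y u : pi_smooth_at A Y u -> vsmooth_at S (gam A Y) u.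
Proof.
move=> Ys i iu; apply: smooth_near_ext (smooth_near_pair (smooth_near_cst 0 _) (Ys i iu)).
apply: (near_fwd aS iu iu) => w iw _.
by rewrite !(rep_fwd aS)// /field_comp gamE slit_tcoord_vertical.
Qed.

Lemma pi_smooth_eta u : pi_smooth_at A eta u.
Proof.
move=> i iu; apply: smooth_near_ext (smooth_near_snd (smooth_near_id _)).
by apply: (near_fwd aS iu iu) => w iw _; rewrite !(rep_fwd aS).
Qed.

Lemma pi_smoothD Y Z u : pi_smooth_at A Y u -> pi_smooth_at A Z u ->
  pi_smooth_at A (fun w => Y w + Z w) u.
Proof.
move=> Ys Zs i iu; apply: smooth_near_ext (smooth_nearD (Ys i iu) (Zs i iu)).
apply: (near_fwd aS iu iu) => w iw _; rewrite !(rep_fwd aS)//.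
by rewrite /tcoord /tdiff linearD.
Qed.

Lemma pi_smoothN Y u : pi_smooth_at A Y u -> pi_smooth_at A (fun w => - Y w) u.
Proof.
move=> Ys i iu; apply: smooth_near_ext (smooth_nearN (Ys i iu)).
apply: (near_fwd aS iu iu) => w iw _; rewrite !(rep_fwd aS)//.
by rewrite /tcoord /tdiff linearN.
Qed.

Lemma pi_smooth0 u : pi_smooth_at A (fun=> 0) u.
Proof.
move=> i iu; apply: smooth_near_ext (smooth_near_cst 0 _).
apply: (near_fwd aS iu iu) => w iw _; rewrite !(rep_fwd aS)//.
by rewrite /tcoord /tdiff linear0.
Qed.

(** The axioms of a connection concern sections, the identities to prove concern vectors. The
    extension has constant components in one chart; taking [rho] of a field on the slit bundle
    reuses [vsmooth_tvec]. *)
Lemma exists_pi_smooth u (e : E) : exists2 Y, pi_smooth_at A Y u & Y u = e.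
Proof.
have du := dom_pref u.
exists (rho A (fun w => tvec (B := S) (pref A (proj u)) w (e, 0))).
  apply: pi_smooth_rho; apply: (vsmooth_tvec aS bEE du).
  apply: smooth_near_ext (smooth_near_cst (e, 0 : E) _).
  by apply: (near_fwd aS du du) => w dw _; rewrite (rep_fwd aS).
rewrite rhoE.
have -> : tvec (B := S) (pref A (proj u)) u (e, 0) = (e, 0).
  exact: (diff_rep_id aS).
by [].
Qed.

Section Regular.
Variable D : @connection R n M.
Hypothesis lD : linear_connection A D.
Hypothesis rD : regular A D.

Lemma conn0r u (w : E * E) : D u w (fun=> 0) = 0.
Proof.
have := conn_add lD w (@pi_smooth0 u) (@pi_smooth0 u).
have -> : (fun q : @slit R n M => (0 : E) + 0) = (fun=> 0) by apply/funext => q; rewrite addr0.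
by move=> H; apply: (addrI (D u w (fun=> 0))); rewrite addr0 -H.
Qed.

Lemma connDl u (v w : E * E) Y : pi_smooth_at A Y u ->
  D u (v + w) Y = D u v Y + D u w Y.
Proof. by move=> Ys; have := conn_linear lD 1 v w Ys; rewrite !scale1r. Qed.

Lemma conn0l u Y : pi_smooth_at A Y u -> D u 0 Y = 0.
Proof.
move=> Ys; have := connDl 0 0 Ys; rewrite addr0 => H.
by apply: (addrI (D u 0 Y)); rewrite addr0 -H.
Qed.

Lemma connZl u (a : R) (w : E * E) Y : pi_smooth_at A Y u ->
  D u (a *: w) Y = a *: D u w Y.
Proof. by move=> Ys; have := conn_linear lD a w 0 Ys; rewrite !addr0 conn0l// addr0. Qed.

Lemma connNl u (w : E * E) Y : pi_smooth_at A Y u -> D u (- w) Y = - D u w Y.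
Proof. by move=> Ys; rewrite -scaleN1r connZl// scaleN1r. Qed.

Lemma connBl u (v w : E * E) Y : pi_smooth_at A Y u ->
  D u (v - w) Y = D u v Y - D u w Y.
Proof. by move=> Ys; rewrite connDl// connNl. Qed.

Lemma horizontal_inj u (v w : E * E) : D u v eta = 0 -> D u w eta = 0 ->
  v.1 = w.1 -> v = w.
Proof.
move=> v0 w0 vw; have [H _] := rD u; apply/eqP; rewrite -subr_eq0; apply/eqP.
have : (vertical A u `&` horizontal D u) (v - w).
  split; first by rewrite /vertical /= tmap_proj /= vw subrr.
  by rewrite /horizontal /= connBl ?v0 ?w0 ?subrr//; exact: pi_smooth_eta.
by rewrite H.
Qed.

Lemma betP Y u : D u (bet A D Y u) eta = 0 /\ (bet A D Y u).1 = Y u.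
Proof.
(* Any vector over [Y u] would serve: its horizontal part has the same projection. *)
have [_ /(_ (Y u, 0)) [v [h [vv hh vh]]]] := rD u.
have : [set w | horizontal D u w /\ tmap S A proj u w = Y u] (bet A D Y u).
  apply: (@xgetPex _ 0); exists h; split=> //; rewrite (tmap_proj u).
  have vv0 : v.1 = 0 by rewrite -(tmap_proj u).
  by have := congr1 (fun z => z.1) vh; rewrite /= vv0 add0r.
by move=> [? ?]; split=> //; rewrite -(tmap_proj u).
Qed.

Lemma bet_eq Y u (w : E * E) : D u w eta = 0 -> w.1 = Y u -> bet A D Y u = w.
Proof. by have [b0 b1] := betP Y u => w0 w1; apply: (horizontal_inj b0 w0); rewrite b1 w1. Qed.

Lemma rho_bet Y : rho A (bet A D Y) = Y.
Proof. by apply/funext => u; rewrite rhoE; have [] := betP Y u. Qed.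

Lemma cov_bet_eta Y : cov D (bet A D Y) eta = fun=> 0.
Proof. by apply/funext => u; have [] := betP Y u. Qed.

(* Regularity only says that the matrix Kmx of [e |-> K (gam e)] is invertible.
   That it is the identity ([conn_vertical_eta]) is derived from the torsion,
   hence from this lemma. *)
Lemma vsmooth_bet Y u : pi_smooth_at A Y u -> vsmooth_at S (bet A D Y) u.
Proof.
move=> Ys; pose i := pref A (proj u); have iu : dom (c := S) i u := dom_pref u.
pose Vf k := fun w => tvec (B := S) i w (0, delta_mx 0 k).
pose Xh := fun w => tvec (B := S) i w (pi_comp i Y w, 0).
have Vs k : vsmooth_at S (Vf k) u.
  apply: (vsmooth_tvec aS bEE iu).
  apply: smooth_near_ext (smooth_near_cst (0 : E, delta_mx 0 k) _).
  by apply: (near_fwd aS iu iu) => w iw _; rewrite (rep_fwd aS).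
have Xs : vsmooth_at S Xh u.
  apply: (vsmooth_tvec aS bEE iu).
  apply: smooth_near_ext (smooth_near_pair (Ys i iu) (smooth_near_cst 0 _)).
  by apply: (near_fwd aS iu iu) => w iw _; rewrite !(rep_fwd aS).
have KVs k : pi_smooth_at A (cov D (Vf k) eta) u.
  by apply: (conn_smooth lD); [exact: Vs|exact: pi_smooth_eta].
have KXs : pi_smooth_at A (cov D Xh eta) u.
  by apply: (conn_smooth lD); [exact: Xs|exact: pi_smooth_eta].
pose Kmx w : 'M[R]_n := \matrix_(k, l) pi_comp i (cov D (Vf k) eta) w ord0 l.
pose b w := pi_comp i (cov D Xh eta) w.
have Kcomb w (s : E) : dom (c := S) i w ->
    pi_comp i (cov D (fun w => tvec (B := S) i w (0, s)) eta) w = s *m Kmx w.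
  move=> iw; rewrite /pi_comp /cov.
  have -> : tvec (B := S) i w (0, s) = \sum_k s ord0 k *: Vf k w.
    rewrite {1}[s]row_sum_delta.
    transitivity (tvec (B := S) i w (linr E E (\sum_k s ord0 k *: delta_mx 0 k))) => //.
    rewrite !linear_sum /tvec linear_sum; apply: eq_bigr => k _.
    by rewrite !linearZ.
  pose Dl := fun v => tcoord i (proj w) (D w v eta).
  have Dl0 : Dl 0 = 0.
    by rewrite /Dl conn0l ?/tcoord/tdiff ?linear0//; exact: pi_smooth_eta.
  have DlD v1 v2 : Dl (v1 + v2) = Dl v1 + Dl v2.
    by rewrite /Dl connDl ?/tcoord ?/tdiff ?linearD//; exact: pi_smooth_eta.
  rewrite -/(Dl _) (big_morph Dl DlD Dl0).
  apply/rowP => l; rewrite summxE mxE; apply: eq_bigr => k _.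
  rewrite /Dl connZl; last exact: pi_smooth_eta.
  by rewrite /tcoord /tdiff linearZ !mxE.
have tvec2 w (a e : E) : dom (c := S) i w ->
    (tvec (B := S) i w (a, e)).1 = tvec i (proj w) a.
  move=> iw; apply: (tcoord_inj iw); rewrite (tvecK aA)//.
  by rewrite -slit_tcoord1// tvecK.
(* A row killed by [Kmx w] is the component row of a vector both vertical and horizontal. *)
have Kunit w : dom (c := S) i w -> Kmx w \in unitmx.
  move=> iw; rewrite -row_free_unit -kermx_eq0; apply/rowV0P => s /sub_kermxP s0.
  have Ks : D w (tvec (B := S) i w (0, s)) eta = 0.
    apply: (tcoord_inj iw); rewrite -[LHS]/(pi_comp i (cov D (fun w => tvec (B := S) i w (0, s)) eta) w).
    by rewrite Kcomb// s0 /tcoord /tdiff linear0.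
  have : tvec (B := S) i w (0, s) = 0.
    apply: (horizontal_inj Ks); first by rewrite conn0l//; exact: pi_smooth_eta.
    by rewrite tvec2// /tvec linear0.
  move=> /(congr1 (tcoord (A := S) i w)); rewrite tvecK//.
  by rewrite {1}/tcoord /tdiff linear0 => -[].
(* [Xh] lifts [Y]; subtracting the vertical vector with components [s w] makes it horizontal exactly
   when [s w *m Kmx w = b w]. *)
pose s w := b w *m invmx (Kmx w).
have ss : smooth_near (rep (A := S) i s) (fwd (c := S) i u).
  pose f z : 'M[R]_n :=
    \matrix_(k, l) rep (A := S) i (pi_comp i (cov D (Vf k) eta)) z ord0 l.
  have fE w : dom (c := S) i w -> f (fwd (c := S) i w) = Kmx w.
    by move=> iw; apply/matrixP => k l; rewrite !mxE (rep_fwd aS).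
  have fs k l : smooth_near (fun z => f z k l) (fwd (c := S) i u).
    have := smooth_near_linear_comp (bcoord_cont bE l) (KVs k i iu).
    by apply: smooth_near_ext; near=> z; rewrite !mxE.
  have fu : f (fwd (c := S) i u) \in unitmx by rewrite fE// Kunit.
  apply: smooth_near_ext (smooth_near_solve fs (KXs i iu) fu).
  by apply: (near_fwd aS iu iu) => w iw _; rewrite !(rep_fwd aS)// fE.
apply: (vsmooth_at_chart aS bEE iu).
apply: smooth_near_ext (smooth_near_pair (Ys i iu) (smooth_nearN ss)).
apply: (near_fwd aS iu iu) => w iw _; rewrite !(rep_fwd aS)//.
rewrite /field_comp (@bet_eq _ _ (tvec (B := S) i w (pi_comp i Y w, - s w))).
- by rewrite tvecK.
- have -> : (pi_comp i Y w, - s w) = (pi_comp i Y w, 0) - (0, s w).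
    by apply: injective_projections => /=; rewrite ?subr0 ?sub0r.
  have -> : tvec (B := S) i w ((pi_comp i Y w, 0) - (0, s w)) = Xh w - tvec (B := S) i w (0, s w).
    by rewrite /tvec linearB.
  rewrite connBl; last exact: pi_smooth_eta.
  apply: (tcoord_inj iw); rewrite /tcoord /tdiff linearB /= linear0.
  have := Kcomb w (s w) iw; rewrite {1}/pi_comp /cov /tcoord /tdiff => ->.
  by rewrite /s mulmxKV ?Kunit// subrr.
- by rewrite tvec2// tcoordK.
Unshelve. all: by end_near. Qed.

End Regular.
End Fields.

(** * Finsler metrics *)

Section Finsler.
Context {R : realType} {n : nat} {M : topologicalType}.
Local Notation E := 'rV[R]_n.
Variable A : charts M E.
Hypothesis hM : smooth_manifold A.
Local Notation S := (slit_charts A).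
Local Notation bE := (@rV_basis R n).
Local Notation bEE := (prod_basis bE bE).
Implicit Types (i j : idx A) (p q : M) (u : @slit R n M).
Implicit Types (Y Z : @slit R n M -> E) (X : @slit R n M -> E * E).
Let aA := manifold_atlas hM.
Let aS := slit_atlas hM.
Variable L : M * E -> R.
Hypothesis hL : finsler A L.

Definition energy p (y : E) : R := L (p, y) ^+ 2 / 2.

(** The metric differentiates [energy] on one fibre, while covariant derivatives act on functions of
    the whole slit bundle. The two readings of the energy are compared through the affine inclusion
    of a fibre. *)
Definition chart_energy i (z : E * E) : R :=
  rep (A := S) i (fun u : slit => L (val u)) z ^+ 2 / 2.

Lemma chart_energy_smooth i u : dom (c := S) i u ->
  smooth_near (chart_energy i) (fwd (c := S) i u).
Proof.
move=> iu; apply: smooth_nearM; last exact: smooth_near_cst.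
by apply: smooth_nearM; exact: finsler_smooth hL u i iu.
Qed.

(* the affine map [y |-> (x, tcoord i p y)] reads a fibre in the chart i *)
Definition fibre_lin i p : {linear E -> (E * E)%type} :=
  linr E E \o 'd (rep (pref A p) (fwd i)) (fwd (pref A p) p).

Lemma fibre_linE i p e : fibre_lin i p e = (0, tcoord i p e).
Proof. by []. Qed.

Lemma fibre_fwd i p y (y0 : y != 0) : dom i p ->
  fwd (c := S) i (exist _ (p, y) y0) = fibre_lin i p y + (fwd i p, 0).
Proof.
by move=> ip; apply: injective_projections; rewrite /= ?add0r ?addr0.
Qed.

Lemma fwd_fibre i u : dom (c := S) i u ->
  fibre_lin i (proj u) (val u).2 + (fwd i (proj u), 0) = fwd (c := S) i u.
Proof.
move=> iu; rewrite -(fibre_fwd (valP u) iu); congr (fwd (c := S) i _).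
by apply: val_inj; case: u {iu} => -[].
Qed.

Lemma near_neq0 (y : E) : y != 0 -> \forall y' \near y, y' != 0.
Proof. by move=> y0; exact: cvgr_neq0 cvg_id y0. Qed.

Lemma energy_chart i p y : dom i p -> y != 0 ->
  energy p y = chart_energy i (fibre_lin i p y + (fwd i p, 0)).
Proof.
move=> ip y0; rewrite -(fibre_fwd y0 ip) /chart_energy (rep_fwd aS)//.
Qed.

(** The premise holds off the zero vector, an open condition, and the conclusion has the same shape,
    so the lemma can be iterated for higher derivatives. *)
Lemma derive_fibre (W : normedModType R) i p (f : E -> W) (g : E * E -> W) (w : E) :
  (forall y, y != 0 -> f y = g (fibre_lin i p y + (fwd i p, 0))) ->
  forall y, y != 0 ->
    'D_w f y = 'D_(fibre_lin i p w) g (fibre_lin i p y + (fwd i p, 0)).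
Proof.
move=> fg y y0; rewrite -derive_comp_affine; apply: near_eq_derive.
exact: filterS fg (near_neq0 y0).
Qed.

Lemma energy_smooth p y : y != 0 -> smooth_near (energy p) y.
Proof.
move=> y0; pose i := pref A p; have ip : dom i p by exact: mfd_pref hM _.
have := chart_energy_smooth (u := exist _ (p, y) y0) (i := i) ip.
rewrite (fibre_fwd y0 ip) => Fs.
have lc : continuous (fibre_lin i p).
  move=> z; apply: continuous_comp; last exact: linr_continuous.
  apply: diff_continuous; apply: smooth_near_differentiable.
  exact: (atlas_transition aA ip ip).
have as_ : smooth_near (fun y => fibre_lin i p y + (fwd i p, 0)) y.
  apply: smooth_nearD; last exact: smooth_near_cst.
  exact: smooth_near_linear.
apply: smooth_near_ext (smooth_near_comp bEE (scalar_basis R) as_ Fs).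
by apply: filterS (near_neq0 y0) => y' y'0; rewrite (energy_chart ip).
Qed.

(** Twice the Cartan tensor, when the latter is normalised as a quarter of the third fibre
    derivative of L^2. *)
Definition third u (x v w : E) : R :=
  'D_x (fun y => 'D_v (fun y => 'D_w (energy (proj u)) y) y) (val u).2.

Lemma metricE u (v w : E) : finsler_metric L u v w
  = 'D_v (fun y => 'D_w (energy (proj u)) y) (val u).2.
Proof. by []. Qed.

Lemma metric_chart i u (v w : E) : dom (c := S) i u -> finsler_metric L u v w
  = hess (linr E E) (chart_energy i) (fwd (c := S) i u)
      (tcoord i (proj u) v) (tcoord i (proj u) w).
Proof.
move=> iu; rewrite metricE.
have D1 := derive_fibre w (fun y => energy_chart iu).
pose g z := 'D_(fibre_lin i (proj u) w) (chart_energy i) z.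
have := derive_fibre (g := g) v D1 (valP u).
move=> ->; rewrite /hess.
by rewrite fwd_fibre.
Qed.

Lemma third_chart u (x v w : E) (i := pref A (proj u)) : third u x v w
  = 'D_(linr E E x) (fun z => hess (linr E E) (chart_energy i) z v w) (fwd (c := S) i u).
Proof.
have iu : dom (c := S) i u by exact: dom_pref hM u.
have D1 := derive_fibre w (fun y => energy_chart iu).
pose g z := 'D_(fibre_lin i (proj u) w) (chart_energy i) z.
have D2 := derive_fibre (g := g) v D1.
pose h z := 'D_(fibre_lin i (proj u) v) g z.
have := derive_fibre (g := h) x D2 (valP u).
rewrite (fwd_fibre iu) /third => ->.
have tl e : fibre_lin i (proj u) e = linr E E e.
  by rewrite fibre_linE (tcoord_pref aA).
by rewrite (tl x) /h (tl v) /g (tl w).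
Qed.

Lemma metric_sym u (v w : E) : finsler_metric L u v w = finsler_metric L u w v.
Proof. by rewrite !metricE; apply: derive_sym; exact: energy_smooth (valP u). Qed.

Lemma derive_energy_smooth u (w : E) :
  smooth_near (fun y => 'D_w (energy (proj u)) y) (val u).2.
Proof. by apply: smooth_near_derive; exact: energy_smooth (valP u). Qed.

Lemma metric_linearl u (w : E) : linear (fun v => finsler_metric L u v w : R^o).
Proof.
move=> a v v'; rewrite !metricE.
have d := smooth_near_differentiable (derive_energy_smooth u w).
by rewrite !deriveE// linearP.
Qed.

Lemma metricBl u (v v' w : E) :
  finsler_metric L u (v - v') w = finsler_metric L u v w - finsler_metric L u v' w.
Proof.
rewrite [v - v']addrC; have := metric_linearl u w (-1) v' v.
by rewrite !scaleN1r => ->; rewrite addrC.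
Qed.

(** Positive definiteness is tested on [v - v'] itself. *)
Lemma metric_eq0 u (v v' : E) :
  (forall w, finsler_metric L u v w = finsler_metric L u v' w) -> v = v'.
Proof.
move=> vv'; apply/eqP; rewrite -subr_eq0; apply: contraT => /(finsler_posdef hL u).
by rewrite metricBl vv' subrr ltxx.
Qed.

Lemma third_sym u (x v w : E) : third u x v w = third u v x w.
Proof. by apply: derive_sym; exact: derive_energy_smooth. Qed.

Lemma energy_homogeneous p (y : E) (t : R) : 0 < t ->
  energy p (t *: y) = t ^+ 2 * energy p y.
Proof.
by move=> t0; rewrite /energy (finsler_homog hL)// exprMn mulrA.
Qed.

(** Each fibre derivative lowers the degree of homogeneity by one, so the Hessian of the energy has
    degree 0 and its radial derivative vanishes. Symmetry moves [eta] into the outer slot. *)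
Lemma third_radial u (x w : E) : third u x (eta u) w = 0.
Proof.
rewrite third_sym; have y0 : (val u).2 != 0 := valP u.
apply: derive_radial y0 => [y y0|y t y0 t0].
  by apply: smooth_near_derive; apply: smooth_near_derive; exact: energy_smooth.
have sm1 y' (y'0 : y' != 0) : smooth_near (fun y => 'D_w (energy (proj u)) y) y'.
  by apply: smooth_near_derive; exact: energy_smooth.
rewrite (derive_homogeneous sm1 (k := 0) x)// ?expr0 ?mul1r//.
move=> y' t' y'0 t'0.
apply: (derive_homogeneous (@energy_smooth _) (k := 1) w) => // y2 t2 y20 t20.
exact: energy_homogeneous.
Qed.

(** Derivative of the components in the preferred chart. For vertical [z] it is the prime of the
    overview, independent of the chart since transitions are linear on fibres. *)
Definition pi_diff Y u (z : E * E) : E := tdiff S u (pi_comp (pref A (proj u)) Y) z.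

Lemma derive_metric u (x : E) Y Z : pi_smooth_at A Y u -> pi_smooth_at A Z u ->
  tdiff S u (fun q : slit => finsler_metric L q (Y q) (Z q)) (0, x)
  = third u x (Y u) (Z u)
    + (finsler_metric L u (pi_diff Y u (0, x)) (Z u)
       + finsler_metric L u (Y u) (pi_diff Z u (0, x))).
Proof.
move=> Ys Zs; pose i := pref A (proj u); have iu : dom (c := S) i u := dom_pref hM u.
pose z0 := fwd (c := S) i u.
pose cY := rep (A := S) i (pi_comp i Y); pose cZ := rep (A := S) i (pi_comp i Z).
have Yd : differentiable cY z0 := smooth_near_differentiable (Ys i iu).
have Zd : differentiable cZ z0 := smooth_near_differentiable (Zs i iu).
have Fs := chart_energy_smooth iu.
pose G := fun z => hess (linr E E) (chart_energy i) z (cY z) (cZ z).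
have repG : \forall z \near z0, rep (A := S) i
    (fun q : slit => finsler_metric L q (Y q) (Z q)) z = G z.
  apply: (near_fwd aS iu iu) => q iq _.
  refine (etrans (rep_fwd aS _ iq) (etrans (metric_chart _ _ iq) _)).
  by rewrite /G /cY /cZ (rep_fwd aS (pi_comp i Y) iq) (rep_fwd aS (pi_comp i Z) iq).
have Gs : smooth_near G z0.
  exact: (hess_smooth bE _ Fs (Ys i iu) (Zs i iu)).
have repG' : \forall z \near z0, G z = rep (A := S) i
    (fun q : slit => finsler_metric L q (Y q) (Z q)) z.
  by apply: filterS repG => z ->.
rewrite /tdiff -(near_eq_diff (0, x) repG' (smooth_near_differentiable Gs)).
rewrite -deriveE; last exact: smooth_near_differentiable.
have tl e : tcoord i (proj u) e = e := tcoord_pref aA (proj u) e.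
have cYu : cY z0 = Y u by rewrite /cY (rep_fwd aS _ iu) /pi_comp tl.
have cZu : cZ z0 = Z u by rewrite /cZ (rep_fwd aS _ iu) /pi_comp tl.
have H := derive_hess bE (linr E E) (0, x) Fs Yd Zd.
rewrite cYu cZu in H.
refine (etrans H _).
rewrite third_chart.
have mE v w : finsler_metric L u v w
    = hess (linr E E) (chart_energy i) (fwd (c := S) i u) v w.
  by rewrite (metric_chart v w iu) (tl v) (tl w).
have dE Z' : pi_smooth_at A Z' u ->
    'D_(0, x) (rep (A := S) i (pi_comp i Z')) z0 = pi_diff Z' u (0, x).
  by move=> Zs'; rewrite deriveE//; exact: smooth_near_differentiable (Zs' i iu).
rewrite (mE (pi_diff Y u (0, x))) (mE (Y u) (pi_diff Z u (0, x))).
rewrite -(dE Y Ys) -(dE Z Zs).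
by [].
Qed.

End Finsler.

(** * Connections *)

Section Brackets.
Context {R : realType} {n : nat} {M : topologicalType}.
Local Notation E := 'rV[R]_n.
Variable A : charts M E.
Hypothesis hM : smooth_manifold A.
Local Notation S := (slit_charts A).
Implicit Types (i j : idx A) (u : @slit R n M).
Implicit Types (Y Z : @slit R n M -> E) (X : @slit R n M -> E * E).
Let aS := slit_atlas hM.

Lemma near_eq_tdiff (W : normedModType R) (f g : @slit R n M -> W) u z :
  (forall w, dom (c := S) (pref A (proj u)) w -> f w = g w) ->
  differentiable (rep (A := S) (pref A (proj u)) f) (fwd (c := S) (pref A (proj u)) u) ->
  tdiff S u f z = tdiff S u g z.
Proof.
move=> fg fd; apply: near_eq_diff fd.
by apply: (rep_near_eq aS) => //; exact: dom_pref hM u.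
Qed.

Lemma field_comp_differentiable X u : vsmooth_at S X u ->
  differentiable (rep (A := S) (pref A (proj u)) (field_comp (A := S) (pref A (proj u)) X))
    (fwd (c := S) (pref A (proj u)) u).
Proof. by move=> Xs; apply: smooth_near_differentiable (Xs _ (dom_pref hM u)). Qed.

Lemma pi_comp_differentiable Y u : pi_smooth_at A Y u ->
  differentiable (rep (A := S) (pref A (proj u)) (pi_comp (pref A (proj u)) Y))
    (fwd (c := S) (pref A (proj u)) u).
Proof. by move=> Ys; apply: smooth_near_differentiable (Ys _ (dom_pref hM u)). Qed.

Lemma tdiff_linear (W W' : normedModType R) (l : {linear W -> W'})
    (f : @slit R n M -> W) u z : continuous l ->
  differentiable (rep (A := S) (pref A (proj u)) f) (fwd (c := S) (pref A (proj u)) u) ->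
  tdiff S u (fun w => l (f w)) z = l (tdiff S u f z).
Proof.
move=> lc fd; pose i := pref A (proj u); have iu : dom (c := S) i u := dom_pref hM u.
have ld : differentiable (fun z => l (rep (A := S) i f z)) (fwd (c := S) i u).
  by apply: (differentiable_comp fd); exact: linear_differentiable.
have E1 := derive_linear z lc fd.
rewrite /tdiff -(deriveE z fd) -[RHS]E1 (deriveE z ld).
apply/esym/near_eq_diff => //.
by apply: (near_fwd aS iu iu) => w iw _; rewrite !(rep_fwd aS).
Qed.

Lemma tdiff_fst X u z : vsmooth_at S X u ->
  (tdiff S u (field_comp (A := S) (pref A (proj u)) X) z).1 = pi_diff A (rho A X) u z.
Proof.
move=> Xs; have Xd := field_comp_differentiable Xs.
rewrite -[LHS](tdiff_linear z (@lfst_continuous R E E) Xd) /pi_diff.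
apply: near_eq_tdiff => [w iw|].
  by rewrite /= /field_comp slit_tcoord1// /pi_comp rhoE.
pose i := pref A (proj u); have iu : dom (c := S) i u := dom_pref hM u.
have Xd1 : differentiable (fun z => lfst E E (rep (A := S) i (field_comp (A := S) i X) z))
    (fwd (c := S) i u).
  by apply: (differentiable_comp Xd); exact: linear_differentiable (@lfst_continuous R E E).
apply: near_eq_differentiable Xd1.
by apply: (near_fwd aS iu iu) => w iw _; rewrite /= !(rep_fwd aS).
Qed.

Lemma tdiff_gam Y u z : pi_smooth_at A Y u ->
  tdiff S u (field_comp (A := S) (pref A (proj u)) (gam A Y)) z = (0, pi_diff A Y u z).
Proof.
move=> Ys; have Yd := pi_comp_differentiable Ys.
have gd := field_comp_differentiable (vsmooth_gam hM Ys).
rewrite -[RHS](tdiff_linear z (@linr_continuous R E E) Yd).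
apply: near_eq_tdiff gd => w iw.
by rewrite /field_comp gamE// slit_tcoord_vertical.
Qed.

(** [gam Y] has no base component, so under [rho] only the derivative of [rho X] along the fibre
    survives. *)
Lemma lie_gam X Y u : vsmooth_at S X u -> pi_smooth_at A Y u ->
  (lie S X (gam A Y) u).1 = - pi_diff A (rho A X) u (0, Y u).
Proof.
move=> Xs Ys; rewrite /lie tdiff_gam//.
rewrite -[LHS]/(0 - (tdiff S u (field_comp (A := S) (pref A (proj u)) X) (gam A Y u)).1).
by rewrite tdiff_fst// gamE// sub0r.
Qed.

Lemma lie_gam_gam Y Z u : pi_smooth_at A Y u -> pi_smooth_at A Z u ->
  lie S (gam A Y) (gam A Z) u
    = (0, pi_diff A Z u (0, Y u) - pi_diff A Y u (0, Z u)).
Proof.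
move=> Ys Zs.
refine (etrans (congr2 (fun a b => a - b) (tdiff_gam _ Zs) (tdiff_gam _ Ys)) _).
rewrite (gamE hM Y u) (gamE hM Z u).
by apply: injective_projections => //; exact: subrr.
Qed.

Lemma lieBl X1 X2 X u : vsmooth_at S X1 u -> vsmooth_at S X2 u ->
  lie S (fun w => X1 w - X2 w) X u = lie S X1 X u - lie S X2 X u.
Proof.
move=> Xs1 Xs2; rewrite /lie.
have d1 := field_comp_differentiable Xs1; have d2 := field_comp_differentiable Xs2.
have iu : dom (c := S) (pref A (proj u)) u := dom_pref hM u.
have -> : tdiff S u (field_comp (A := S) (pref A (proj u)) (fun w => X1 w - X2 w)) (X u)
  = tdiff S u (field_comp (A := S) (pref A (proj u)) X1) (X u)
    - tdiff S u (field_comp (A := S) (pref A (proj u)) X2) (X u).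
  rewrite /tdiff; have := congr1 (fun h => h (X u)) (diffB d1 d2) => /= <-.
  apply/esym/near_eq_diff; last exact: differentiableB.
  apply: (near_fwd aS iu iu) => w iw _; rewrite -[LHS]/(_ - _) !(rep_fwd aS)//.
  by rewrite /field_comp /tcoord /tdiff linearB.
have tB f (a b : E * E) : tdiff S u f (a - b) = tdiff S u f a - tdiff S u f b :> E * E.
  by rewrite /tdiff linearB.
rewrite tB !opprB addrACA [RHS]addrACA; congr (_ + _); exact: addrC.
Qed.

Lemma lie0l X u : lie S (fun=> 0) X u = 0.
Proof.
have s0 : vsmooth_at S (fun=> 0) u.
  have := vsmooth_gam hM (@pi_smooth0 _ _ _ _ hM u).
  by have -> : gam A (fun=> 0) = (fun=> 0) by apply/funext => w; rewrite gamE.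
have := lieBl X s0 s0.
have -> : (fun w : @slit R n M => (0 : E * E) - 0) = (fun=> 0).
  by apply/funext => w; rewrite subr0.
by rewrite subrr.
Qed.

Lemma pi_diff_eta u (x : E) : pi_diff A eta u (0, x) = x.
Proof.
have iu : dom (c := S) (pref A (proj u)) u := dom_pref hM u.
rewrite /pi_diff /tdiff -(@near_eq_diff _ _ _ (lsnd E E)).
- by rewrite (diff_lin _ (@lsnd_continuous R E E)).
- by apply: (near_fwd aS iu iu) => w iw _; rewrite (rep_fwd aS).
- exact: linear_differentiable (@lsnd_continuous R E E).
Qed.

End Brackets.

(** * Torsion, vertical part and curvature of the Cartan connection *)

Section Cartan.
Context {R : realType} {n : nat} {M : topologicalType}.
Local Notation E := 'rV[R]_n.
Variable A : charts M E.
Hypothesis hM : smooth_manifold A.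
Local Notation S := (slit_charts A).
Implicit Types (u : @slit R n M).
Implicit Types (X Y Z : @slit R n M -> E).
Local Opaque finsler_metric third pi_diff.
Variable L : M * E -> R.
Hypothesis hL : finsler A L.
Variable D : @connection R n M.
Hypothesis hD : cartan_connection A L D.
Let lD := cartan_linear hD.
Let rD := cartan_regular hD.

(** Since [rho] kills [gam X], one covariant term of the torsion drops out, and the base part of the
    bracket is the fibre derivative of [Y]. Splitting that bracket requires [bet Y] to be smooth. *)
Lemma TtorE X Y u : pi_smooth_at A X u -> pi_smooth_at A Y u ->
  Ttor A D X Y u = D u (0, X u) Y - pi_diff A Y u (0, X u).
Proof.
move=> Xs Ys; rewrite /Ttor /torsion /cov rho_bet//.
have -> : rho A (gam A X) = fun=> 0 by apply/funext => w; rewrite rhoE// gamE.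
rewrite (conn0r hM lD) subr0 rhoE// gamE//; congr (_ - _).
have Bs := vsmooth_bet hM lD rD Ys.
rewrite /lie tdiff_gam// gamE//.
rewrite -[LHS]/((tdiff S u (field_comp (A := S) (pref A (proj u)) (bet A D Y)) (0, X u)).1 - 0).
rewrite subr0 (tdiff_fst hM _ Bs).
by rewrite rho_bet.
Qed.

(** Compare two derivatives of [g (Y, Z)] along the fibre: the product rule in a chart and metric
    compatibility. The difference is [third = g (T (X, Y), Z) + g (T (X, Z), Y)], and the axiom on
    [T] makes the two summands equal. *)
Lemma metric_Ttor X Y Z u :
  pi_smooth_at A X u -> pi_smooth_at A Y u -> pi_smooth_at A Z u ->
  finsler_metric L u (Ttor A D X Y u) (Z u) *+ 2 = third L u (X u) (Y u) (Z u).
Proof.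
move=> Xs Ys Zs.
have := etrans (esym (derive_metric hM hL (X u) Ys Zs)) (cartan_metric hD (0, X u) Ys Zs).
rewrite (metric_sym hM hL u (Y u)) (metric_sym hM hL u (Y u)) => H.
have HT := cartan_T hD Xs Ys Zs.
rewrite mulr2n; refine (etrans (congr1 (fun t => _ + t) HT) _).
rewrite (TtorE Xs Ys) (TtorE Xs Zs).
refine (etrans (congr2 +%R (metricBl hM hL _ _ _ _) (metricBl hM hL _ _ _ _)) _).
have alg (t p q a b : R) : t + (p + q) = a + b -> (a - p) + (b - q) = t.
  by move=> abE; rewrite addrACA -opprD -abE addrK.
exact: (alg _ _ _ _ _ H).
Qed.

Lemma Ttor_sym X Y u : pi_smooth_at A X u -> pi_smooth_at A Y u ->
  Ttor A D X Y u = Ttor A D Y X u.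
Proof.
move=> Xs Ys; apply: (metric_eq0 hM hL (u := u)) => e.
have [Z Zs <-] := exists_pi_smooth hM u e.
apply: (@pmulrnI R 2 isT).
refine (etrans (metric_Ttor Xs Ys Zs) (esym (etrans (metric_Ttor Ys Xs Zs) _))).
exact: (third_sym hM hL).
Qed.

(** The torsion [T (X, eta)] vanishes by [third_radial], and the fibre derivative of [eta] along [X]
    is [X]. *)
Lemma conn_vertical_eta u (e : E) : D u (0, e) eta = e.
Proof.
have [X Xs <-] := exists_pi_smooth hM u e.
have es := @pi_smooth_eta _ _ _ _ hM u.
apply/eqP; rewrite -subr_eq0 -{2}(pi_diff_eta hM u (X u)) -TtorE//; apply/eqP.
apply: (metric_eq0 hM hL (u := u)) => e'.
have [Z Zs <-] := exists_pi_smooth hM u e'.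
apply: (@pmulrnI R 2 isT); refine (etrans (metric_Ttor Xs es Zs) _).
rewrite (third_radial hM hL).
have /= -> := linear0 (HB.pack (fun v => finsler_metric L u v (Z u) : R^o)
  (GRing.isLinear.Build R E R^o _ _ (metric_linearl hM hL u (Z u)))).
by rewrite mul0rn.
Qed.

(** This is the symmetry of [T]. The right-hand side is the fibre part of the bracket of the
    vertical lifts, on which [K] is the identity. *)
Lemma conn_vertical_sym X Y u : pi_smooth_at A X u -> pi_smooth_at A Y u ->
  D u (0, X u) Y - D u (0, Y u) X = pi_diff A Y u (0, X u) - pi_diff A X u (0, Y u).
Proof.
move=> Xs Ys; have := Ttor_sym Xs Ys; rewrite (TtorE Xs Ys) (TtorE Ys Xs).
move: (D u _ Y) (D u _ X) (pi_diff A Y u _) (pi_diff A X u _) => a b p q H.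
have -> : a = b - q + p by rewrite -H subrK.
by rewrite addrAC [b - q]addrC addrK addrC.
Qed.

Lemma cov_gam_eta Y : cov D (gam A Y) eta = Y.
Proof. by apply/funext => u; rewrite /cov gamE// conn_vertical_eta. Qed.

(** [D u (a, 0) eta] gives the coefficients of the nonlinear connection in the preferred chart. *)
Lemma etaE u (z : E * E) : D u z eta = D u (z.1, 0) eta + z.2.
Proof.
have {1}-> : z = (z.1, 0) + (0, z.2).
  by apply: injective_projections; rewrite /= ?addr0 ?add0r.
by rewrite (connDl lD) ?conn_vertical_eta//; exact: pi_smooth_eta.
Qed.

Lemma bet_val Y u : bet A D Y u = (Y u, - D u (Y u, 0) eta).
Proof. by apply: bet_eq => //; rewrite etaE /= subrr. Qed.

(** As sections, [D_(gam Z) eta] is [Z] and [D_(bet Y) eta] is 0, so each may be differentiated once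
    more. *)
Lemma PhatE Y Z u : Phat A D Y Z u
  = - D u (bet A D Y u) Z + D u (lie S (bet A D Y) (gam A Z) u) eta.
Proof.
rewrite /Phat /Pcurv /curvature cov_gam_eta cov_bet_eta//.
by rewrite {2}/cov (conn0r hM lD) addr0.
Qed.

Lemma Phat0 Z u : pi_smooth_at A Z u -> Phat A D (fun=> 0) Z u = 0.
Proof.
move=> Zs; rewrite PhatE.
have -> : bet A D (fun=> 0) = fun=> 0.
  apply/funext => w; apply: bet_eq => //.
  by rewrite (conn0l lD)//; exact: pi_smooth_eta.
rewrite lie0l// !(conn0l lD)// ?oppr0 ?addr0//; exact: pi_smooth_eta.
Qed.

Lemma hashiguchi_gam Y Z u : pi_smooth_at A Z u ->
  hashiguchi A D (gam A Y) Z u = D u (0, Y u) Z.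
Proof.
move=> Zs; rewrite /hashiguchi.
have -> : rho A (gam A Y) = fun=> 0 by apply/funext => w; rewrite rhoE// gamE.
by rewrite Phat0// addr0 /cov gamE.
Qed.

(** The term of [Phat] along [bet (rho X)] cancels the horizontal part of [D_X Y]; what remains is
    the derivative along the vertical part [gam (K X)]. *)
Lemma hashiguchiE (X : @slit R n M -> E * E) Y u : pi_smooth_at A Y u ->
  hashiguchi A D X Y u = D u (0, D u (X u) eta) Y
    + D u (lie S (bet A D (rho A X)) (gam A Y) u) eta.
Proof.
move=> Ys; rewrite /hashiguchi /cov PhatE addrA; congr (_ + _).
rewrite -(connBl lD)//; congr (D u _ Y); rewrite bet_val (etaE u (X u)) rhoE//.
apply: injective_projections; first exact: subrr.
by rewrite -[LHS]/((X u).2 - - D u ((X u).1, 0) eta) opprK addrC.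
Qed.

End Cartan.

(** * The conformal change *)

Section Change.
Context {R : realType} {n : nat} {M : topologicalType}.
Local Notation E := 'rV[R]_n.
Variable A : charts M E.
Hypothesis hM : smooth_manifold A.
Local Notation S := (slit_charts A).
Implicit Types (u : @slit R n M).
Implicit Types (X Y Z : @slit R n M -> E).
Variables (L Lt : M * E -> R) (sigma : M -> R).
Hypothesis hL : finsler A L.
Hypothesis hLt : finsler A Lt.
Hypothesis hconf : conformal A L Lt sigma.
Variables D Dt : @connection R n M.
Hypothesis hD : cartan_connection A L D.
Hypothesis hDt : cartan_connection A Lt Dt.
Let lD := cartan_linear hD.
Let lDt := cartan_linear hDt.
Let rD := cartan_regular hD.
Let rDt := cartan_regular hDt.

Lemma third_conformal u (x v w : E) :
  third Lt u x v w = expR (2 * sigma (proj u)) * third L u x v w.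
Proof.
have [_ _ gE] := hconf; rewrite /third.
pose h (L0 : M * E -> R) y := 'D_v (fun y => 'D_w (energy L0 (proj u)) y) y.
(* The metrics are compared at nonzero vectors only, which form a neighbourhood of each of them. *)
have hE : \forall y \near (val u).2,
    h Lt y = (fun y => expR (2 * sigma (proj u)) *: h L y) y.
  apply: filterS (near_neq0 (valP u)) => y y0.
  exact: gE (exist _ (proj u, y) y0) v w.
refine (etrans (near_eq_derive x hE) _); apply: deriveZ.
apply: diff_derivable; apply: smooth_near_differentiable; apply: smooth_near_derive.
exact: (derive_energy_smooth hM hL u w).
Qed.

(** The conformal factor multiplies both the metric and [third], so it cancels and the torsions
    agree. They differ from the covariant derivatives by [pi_diff], which does not involve the
    Finsler function. *)
Lemma conn_vertical_conformal u (e : E) Y : pi_smooth_at A Y u ->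
  Dt u (0, e) Y = D u (0, e) Y.
Proof.
move=> Ys; have [X Xs <-] := exists_pi_smooth hM u e.
have TT : Ttor A Dt X Y u = Ttor A D X Y u.
  apply: (metric_eq0 hM hL (u := u)) => e'.
  have [Z Zs <-] := exists_pi_smooth hM u e'.
  have [_ _ gE] := hconf.
  have e0 : expR (2 * sigma (proj u)) != 0 by rewrite gt_eqF// expR_gt0.
  have Et := metric_Ttor hM hLt hDt Xs Ys Zs.
  rewrite third_conformal gE -mulrnAr in Et.
  have Eg := metric_Ttor hM hL hD Xs Ys Zs.
  apply: (@pmulrnI R 2 isT); apply: (mulfI e0).
  exact: (etrans Et (congr1 _ (esym Eg))).
have := TT; rewrite (TtorE hM hDt Xs Ys) (TtorE hM hD Xs Ys).
exact: addIr.
Qed.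

(** The tensor [N] as a pointwise map, whereas [Nten] acts on sections: the difference of the two
    nonlinear connections in the preferred chart. *)
Definition Nval u (a : E) : E := Dt u (a, 0) eta - D u (a, 0) eta.

Lemma NtenE X u : Nten A D Dt X u = Nval u (X u).
Proof.
rewrite /Nten /cov; have [-> _] := betP hM rD X u.
by rewrite subr0 (bet_val hM hL hD) (etaE hM hLt hDt).
Qed.

Lemma NvalB u (a b : E) : Nval u (a - b) = Nval u a - Nval u b.
Proof.
have pE : (a - b, 0 : E) = (a, 0) - (b, 0).
  by apply: injective_projections => //=; rewrite subr0.
have es := @pi_smooth_eta _ _ _ _ hM u.
rewrite /Nval pE (connBl lD)// (connBl lDt)// !opprB addrACA [RHS]addrACA.
by congr (_ + _); exact: addrC.
Qed.

Lemma NvalN u (a : E) : Nval u (- a) = - Nval u a.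
Proof.
have N0 : Nval u 0 = 0 by rewrite -[X in Nval u X](subrr 0) NvalB subrr.
by rewrite -sub0r NvalB N0 sub0r.
Qed.

Lemma conn_eta_change u (z : E * E) : Dt u z eta = D u z eta + Nval u z.1.
Proof.
rewrite (etaE hM hLt hDt) (etaE hM hL hD) /Nval.
by rewrite addrAC [D u _ _ + _]addrC subrK.
Qed.

(** Needed because [N (rho X)] is itself differentiated, by [D] and in Lie brackets. *)
Lemma pi_smooth_Nten X u : pi_smooth_at A X u -> pi_smooth_at A (Nten A D Dt X) u.
Proof.
move=> Xs; have es := @pi_smooth_eta _ _ _ _ hM u.
have Bs := vsmooth_bet hM lD rD Xs.
have := pi_smoothD hM (conn_smooth lDt Bs es) (pi_smoothN hM (conn_smooth lD Bs es)).
by [].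
Qed.

Lemma bet_change X :
  bet A Dt X = fun w => bet A D X w - gam A (Nten A D Dt X) w.
Proof.
apply/funext => w; apply: (bet_eq hM lDt rDt).
  have es := @pi_smooth_eta _ _ _ _ hM w.
  rewrite (connBl lDt)// gamE// (conn_vertical_eta hM hLt hDt).
  by rewrite /Nten /cov; have [-> _] := betP hM rD X w; rewrite subr0 subrr.
by rewrite gamE// /= subr0; have [_ ->] := betP hM rD X w.
Qed.

(** With [W = rho X], the term [N (D_(gam Y) W)] occurs in the derivative of [N] and in [N T] with
    opposite signs, so omega* is [D_(gam Y) (N W)] minus [N] of the fibre derivative of [W] along
    [Y]. On the other side, [N] sees only the base part of the bracket, which yields the second
    term, and [conn_vertical_sym] trades the derivative of [Y] along [gam (N W)] for the first. *)
Lemma hashiguchi_change (X : @slit R n M -> E * E) Y u :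
  vsmooth_at S X u -> pi_smooth_at A Y u ->
  hashiguchi A Dt X Y u = hashiguchi A D X Y u + omega_star A D Dt X Y u.
Proof.
move=> Xs Ys; pose W := rho A X; have Ws : pi_smooth_at A W u := pi_smooth_rho hM Xs.
have NWs := pi_smooth_Nten Ws.
have Bs := vsmooth_bet hM lD rD Ws; have Gs := vsmooth_gam hM NWs.
set NW := Nten A D Dt W in NWs Gs.
have es := @pi_smooth_eta _ _ _ _ hM u.
rewrite (hashiguchiE hM hLt hDt X Ys) (hashiguchiE hM hL hD X Ys).
rewrite -/W conn_vertical_conformal// bet_change -/NW (lieBl hM _ Bs Gs).
rewrite (lie_gam_gam hM NWs Ys).
set l1 := lie S (bet A D W) (gam A Y) u.
have l11 : l1.1 = - pi_diff A W u (0, Y u).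
  by rewrite /l1 (lie_gam hM Bs Ys) (rho_bet hM rD).
have omegaE : omega_star A D Dt X Y u
    = D u (0, Y u) NW - Nval u (D u (0, Y u) W) + (Nval u (D u (0, Y u) W)
      - Nval u (pi_diff A W u (0, Y u))).
  rewrite /omega_star /hash_dN -/W -/NW (hashiguchi_gam hM hL hD Y NWs).
  rewrite !NtenE (hashiguchi_gam hM hL hD Y Ws).
  by rewrite (TtorE hM hD Ys Ws) NvalB.
have XE : (0 : E, Dt u (X u) eta) = (0, D u (X u) eta) + (0, NW u).
  apply: injective_projections; first by rewrite /= addr0.
  by rewrite /= conn_eta_change /NW NtenE /W rhoE.
rewrite omegaE XE (connDl lD _ _ Ys) (connBl lDt _ _ es).
rewrite (conn_vertical_eta hM hLt hDt) conn_eta_change l11 NvalN.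
rewrite -(conn_vertical_sym hM hL hD NWs Ys).
move: (D u (0, D u (X u) eta) Y) (D u (0, NW u) Y) (D u l1 eta) (D u (0, Y u) NW)
  (Nval u (D u (0, Y u) W)) (Nval u (pi_diff A W u (0, Y u))) => d m l s a q.
by rewrite subrKA opprB addrACA [m + _]addrC subrK !addrA [in RHS]addrAC.
Qed.

Lemma hashiguchi_gam_change X Y u : pi_smooth_at A X u -> pi_smooth_at A Y u ->
  hashiguchi A Dt (gam A X) Y u = hashiguchi A D (gam A X) Y u.
Proof.
move=> Xs Ys; rewrite (hashiguchi_gam hM hLt hDt X Ys) (hashiguchi_gam hM hL hD X Ys).
exact: conn_vertical_conformal.
Qed.

(** Both omega* and the [Phat] term depend on the field only through its projection, which is the
    same for the two horizontal lifts; the rest is [bet_change] and linearity of [D] in the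
    direction. *)
Lemma hashiguchi_bet_change X Y u : pi_smooth_at A X u -> pi_smooth_at A Y u ->
  hashiguchi A Dt (bet A Dt X) Y u
    = hashiguchi A D (bet A D X) Y u - hashiguchi A D (gam A (Nten A D Dt X)) Y u
      + B_star A D Dt X Y u.
Proof.
move=> Xs Ys; rewrite (hashiguchi_change (vsmooth_bet hM lDt rDt Xs) Ys).
rewrite /B_star /omega_star (rho_bet hM rDt) (rho_bet hM rD); congr (_ + _).
rewrite (hashiguchi_gam hM hL hD _ Ys) /hashiguchi.
rewrite (rho_bet hM rDt) (rho_bet hM rD) addrAC; congr (_ + _).
by rewrite /cov bet_change (connBl lD _ _ Ys) gamE.
Qed.

End Change.

Theorem theorem2p9 (R : realType) (n : nat) (M : topologicalType)
    (A : charts M 'rV[R]_n) (hM : smooth_manifold A)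
    (L Lt : M * 'rV[R]_n -> R) (hL : finsler A L) (hLt : finsler A Lt)
    (sigma : M -> R) (hconf : conformal A L Lt sigma)
    (D Dt : @connection R n M)
    (hD : cartan_connection A L D) (hDt : cartan_connection A Lt Dt) :
  (forall (X : slit -> 'rV[R]_n * 'rV[R]_n) (Y : slit -> 'rV[R]_n),
      vsmooth (slit_charts A) X -> pi_smooth A Y ->
    forall u : slit,
      hashiguchi A Dt X Y u = hashiguchi A D X Y u + omega_star A D Dt X Y u)
  /\
  (forall X Y : slit -> 'rV[R]_n, pi_smooth A X -> pi_smooth A Y ->
    forall u : slit,
      hashiguchi A Dt (gam A X) Y u = hashiguchi A D (gam A X) Y u)
  /\
  (forall X Y : slit -> 'rV[R]_n, pi_smooth A X -> pi_smooth A Y ->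
    forall u : slit,
      hashiguchi A Dt (bet A Dt X) Y u
      = hashiguchi A D (bet A D X) Y u
        - hashiguchi A D (gam A (Nten A D Dt X)) Y u
        + B_star A D Dt X Y u).
Proof.
split=> [X Y Xs Ys u|]; first exact: (hashiguchi_change hM hL hLt hconf hD hDt (Xs u) (Ys u)).
split=> X Y Xs Ys u.
  exact: (hashiguchi_gam_change hM hL hLt hconf hD hDt (Xs u) (Ys u)).
exact: (hashiguchi_bet_change hM hL hLt hconf hD hDt (Xs u) (Ys u)).
Qed.
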